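(* Let $R$ be a (commutative) local noetherian domain of Krull dimension $1$ with quotient field $K$ and with reduced completion $\widehat{R}$. Let $K(\widehat{R})$ denote the total quotient ring of $\widehat{R}$. Let $M_R$ be a finitely generated torsion-free $R$-module, and put $\widehat{M}=M\otimes_R\widehat{R}$. Then the following statements are equivalent, for a countably generated $\widehat{R}$-module $N\in\mathrm{Add}(\widehat{M}_{\widehat{R}})$: (i) $N$ is extended from an $R$-module; (ii) there exists a countable set $\Lambda$ such that $N\otimes_{\widehat{R}}K(\widehat{R})\cong K(\widehat{R})^{(\Lambda)}$; (iii) $N$ is extended from a countably generated module in $\mathrm{Add}(M_R)$.
   Context: $\widehat{R}$ is the completion of $R$ with respect to its maximal ideal. $\mathrm{Add}(M)$ denotes the class of modules isomorphic to direct summands of arbitrary direct sums of copies of $M$. An $\widehat{R}$-module $N$ is extended from an $R$-module $X$ if $N\cong X\otimes_R\widehat{R}$ as $\widehat{R}$-modules. ''Countable'' includes finite; $L^{(\Lambda)}$ is the direct sum of $|\Lambda|$ copies of $L$. *)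

(* Defs.v *)
From HB Require Import structures.
From mathcomp Require Import all_boot all_algebra.
From mathcomp Require Import generic_quotient.
From mathcomp Require Import boolp classical_sets functions cardinality.

Set Implicit Arguments.
Unset Strict Implicit.
Unset Printing Implicit Defensive.

Import GRing.Theory.
Local Open Scope classical_set_scope.
Local Open Scope quotient_scope.
Local Open Scope ring_scope.

Definition isomorphic (R : pzRingType) (X Y : lmodType R) : Prop :=
  exists f : {linear X -> Y}, bijective f.

Definition span (R : pzRingType) (V : lmodType R) (A : set V) : set V :=
  [set x | exists (n : nat) (c : 'I_n -> R) (v : 'I_n -> V),
     (forall i, A (v i)) /\ x = \sum_(i < n) c i *: v i].

Definition finitely_generated (R : pzRingType) (V : lmodType R) : Prop :=
  exists A : set V, finite_set A /\ span A = [set: V].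

Definition countably_generated (R : pzRingType) (V : lmodType R) : Prop :=
  exists A : set V, countable A /\ span A = [set: V].

Definition torsion_free (R : idomainType) (V : lmodType R) : Prop :=
  forall (a : R) (x : V), a *: x = 0 -> a = 0 \/ x = 0.

Section Ideals.
Variable R : comPzRingType.
Implicit Types I J P m : set R.

Definition ideal I : Prop :=
  [/\ I 0, (forall x y, I x -> I y -> I (x + y))
    & (forall a x, I x -> I (a * x))].

Definition prime_ideal P : Prop :=
  [/\ ideal P, ~ P 1 & forall x y, P (x * y) -> P x \/ P y].

Definition maximal_ideal m : Prop :=
  [/\ ideal m, ~ m 1
    & forall J, ideal J -> ~ J 1 -> m `<=` J -> J = m].

Definition local_ring_with m : Prop :=
  maximal_ideal m /\ forall m', maximal_ideal m' -> m' = m.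

Definition ideal_span (A : set R) : set R := @span R R^o A.

Definition ideal_pow I (n : nat) : set R :=
  ideal_span [set x | exists a : 'I_n -> R,
    (forall i, I (a i)) /\ x = \prod_(i < n) a i].

Lemma ideal_spanP (A : set R) : ideal (ideal_span A).
Proof.
split.
- by exists 0%N, (fun=> 0), (fun=> 0); split=> [[]//|]; rewrite big_ord0.
- move=> x y [n [c [v [hv ->]]]] [p [d [w [hw ->]]]].
  exists (n + p)%N,
    (fun i : 'I_(n + p) => match fintype.split i with inl j => c j | inr j => d j end),
    (fun i : 'I_(n + p) => match fintype.split i with inl j => v j | inr j => w j end).
  split; first by move=> i; case: (fintype.split i).
  rewrite big_split_ord /=; congr (_ + _); apply: eq_bigr => i _.
    by rewrite (unsplitK (inl i)).
  by rewrite (unsplitK (inr i)).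
- move=> a x [n [c [v [hv ->]]]]; exists n, (fun i => a * c i), v; split=> //.
  by rewrite mulr_sumr; apply: eq_bigr => i _; rewrite /GRing.scale /= mulrA.
Qed.

Lemma ideal_pow0 I n : ideal_pow I n 0.
Proof. by rewrite /ideal_pow; set A := mkset _; case: (ideal_spanP A). Qed.

Lemma ideal_powD I n x y :
  ideal_pow I n x -> ideal_pow I n y -> ideal_pow I n (x + y).
Proof.
by rewrite /ideal_pow; set A := mkset _; case: (ideal_spanP A) => _ + _; apply.
Qed.

Lemma ideal_powM I n a x : ideal_pow I n x -> ideal_pow I n (a * x).
Proof.
by rewrite /ideal_pow; set A := mkset _; case: (ideal_spanP A) => _ _; apply.
Qed.

Lemma ideal_powN I n x : ideal_pow I n x -> ideal_pow I n (- x).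
Proof. by rewrite -mulN1r; apply: ideal_powM. Qed.

End Ideals.

Definition noetherian (R : comPzRingType) : Prop :=
  forall I : set R, ideal I -> exists A, finite_set A /\ I = ideal_span A.

Definition prime_chain (R : comPzRingType) (n : nat) (P : nat -> set R) : Prop :=
  (forall i, (i <= n)%N -> prime_ideal (P i)) /\
  (forall i, (i < n)%N -> P i `<` P i.+1).

Definition krull_dim (R : comPzRingType) (n : nat) : Prop :=
  (exists P : nat -> set R, prime_chain n P) /\
  (forall k (P : nat -> set R), prime_chain k P -> (k <= n)%N).

Definition reduced (R : comPzRingType) : Prop :=
  forall (x : R) (n : nat), x ^+ n = 0 -> x = 0.

(* [dsum L V] is V^(L): families L -> V with finite support. *)
Section DirectSum.
Variables (R : pzRingType) (L : Type) (V : lmodType R).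

Definition finsupp : {pred L -> V} :=
  [pred f : L -> V | `[< finite_set [set i | f i <> 0] >]].

Lemma finsupp_submod : submod_closed finsupp.
Proof.
split.
  apply/asboolP; rewrite (_ : [set _ | _] = set0) //.
  by apply/seteqP; split => i //=; apply.
move=> a f g /asboolP hf /asboolP hg; apply/asboolP.
apply: (@sub_finite_set _ _ ([set i | f i <> 0] `|` [set i | g i <> 0])).
  move=> i /= h; case: (pselect (f i = 0)) => [f0|]; last by left.
  right=> g0; apply: h.
  by rewrite -[LHS]/(a *: f i + g i) f0 g0 scaler0 addr0.
by rewrite finite_setU.
Qed.

HB.instance Definition _ := GRing.isSubmodClosed.Build R (L -> V) finsupp
  finsupp_submod.

Record dsum := DSum { dsum_val :> L -> V; _ : dsum_val \in finsupp }.

HB.instance Definition _ := [isSub for dsum_val].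
HB.instance Definition _ := [Choice of dsum by <:].
HB.instance Definition _ := [SubChoice_isSubLmodule of dsum by <:].

End DirectSum.

Definition in_Add (R : pzRingType) (M X : lmodType R) : Prop :=
  exists (L : Type) (Y : lmodType R),
    isomorphic (X * Y)%type (dsum L M).

(* [base_change phi X] is the S-module X \otimes_R S, S being an R-algebra
   through phi: formal sums of pairs (x, s), standing for x \otimes s, modulo
   the congruence generated by the bilinearity relations. *)
Section BaseChange.
Variables (R S : comPzRingType) (phi : {rmorphism R -> S}) (X : lmodType R).

Definition formal_sum := seq (X * S).

Inductive tensor_eq : formal_sum -> formal_sum -> Prop :=
| tensor_refl t : tensor_eq t t
| tensor_sym t u : tensor_eq t u -> tensor_eq u t
| tensor_trans t u v : tensor_eq t u -> tensor_eq u v -> tensor_eq t v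
| tensor_cat t t' u u' :
    tensor_eq t t' -> tensor_eq u u' -> tensor_eq (t ++ u) (t' ++ u')
| tensor_catC t u : tensor_eq (t ++ u) (u ++ t)
| tensor_0l s : tensor_eq [:: (0, s)] [::]
| tensor_Dl x y s : tensor_eq [:: (x + y, s)] [:: (x, s); (y, s)]
| tensor_Dr x s s' : tensor_eq [:: (x, s + s')] [:: (x, s); (x, s')]
| tensor_bal a x s : tensor_eq [:: (a *: x, s)] [:: (x, phi a * s)].

Definition tensor_eqb (t u : formal_sum) : bool := `[< tensor_eq t u >].

Lemma tensor_eqb_equiv : equiv_class_of tensor_eqb.
Proof.
split.
- by move=> t; apply/asboolP; constructor.
- by move=> t u; apply/asboolP/asboolP => /tensor_sym.
- by move=> u t v /asboolP tu /asboolP uv; apply/asboolP/(tensor_trans tu uv).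
Qed.

Canonical tensor_equiv := EquivRelPack tensor_eqb_equiv.

Definition base_change := {eq_quot tensor_equiv}.
HB.instance Definition _ := Choice.on base_change.
HB.instance Definition _ := EqQuotient.on base_change.

Lemma base_changeP (t u : formal_sum) :
  \pi_base_change t = \pi_base_change u <-> tensor_eq t u.
Proof. by split=> [/eqmodP/asboolP|h]; last exact/eqmodP/asboolP. Qed.

Lemma base_change_ind (P : base_change -> Prop) :
  (forall t, P (\pi_base_change t)) -> forall p, P p.
Proof. by move=> h p; rewrite -[p]reprK. Qed.

Definition tensor (x : X) (s : S) : base_change := \pi_base_change [:: (x, s)].

Definition fs_opp (t : formal_sum) : formal_sum := [seq (- p.1, p.2) | p <- t].
Definition fs_scale (a : S) (t : formal_sum) : formal_sum :=
  [seq (p.1, a * p.2) | p <- t].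

Definition bc_add (p q : base_change) : base_change :=
  \pi_base_change (repr p ++ repr q).
Definition bc_opp (p : base_change) : base_change :=
  \pi_base_change (fs_opp (repr p)).
Definition bc_scale (a : S) (p : base_change) : base_change :=
  \pi_base_change (fs_scale a (repr p)).

Lemma repr_tensor_eq (t : formal_sum) : tensor_eq (repr (\pi_base_change t)) t.
Proof. by apply/base_changeP; rewrite reprK. Qed.

Lemma tensor_0r x : tensor_eq [:: (x, 0)] [::].
Proof.
have h : tensor_eq [:: (0 *: x, 0)] [:: (x, phi 0 * 0)] by constructor.
rewrite mulr0 scale0r in h.
exact: tensor_trans (tensor_sym h) (tensor_0l 0).
Qed.

Lemma fs_opp_eq t u : tensor_eq t u -> tensor_eq (fs_opp t) (fs_opp u).
Proof.
elim=> {t u} [t|t u _|t u v _ tu _ uv|t t' u u' _ h _ h'|t u|s|x y s|x s s'|a x s].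
- by constructor.
- by apply: tensor_sym.
- exact: tensor_trans tu uv.
- by rewrite /fs_opp !map_cat; apply: tensor_cat.
- by rewrite /fs_opp !map_cat; apply: tensor_catC.
- by rewrite /fs_opp /= oppr0; constructor.
- by rewrite /fs_opp /= opprD; constructor.
- by rewrite /fs_opp /=; constructor.
- by rewrite /fs_opp /= -scalerN; constructor.
Qed.

Lemma fs_scale_eq a t u : tensor_eq t u -> tensor_eq (fs_scale a t) (fs_scale a u).
Proof.
elim=> {t u} [t|t u _|t u v _ tu _ uv|t t' u u' _ h _ h'|t u|s|x y s|x s s'|b x s].
- by constructor.
- by apply: tensor_sym.
- exact: tensor_trans tu uv.
- by rewrite /fs_scale !map_cat; apply: tensor_cat.
- by rewrite /fs_scale !map_cat; apply: tensor_catC.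
- by rewrite /fs_scale /=; constructor.
- by rewrite /fs_scale /=; constructor.
- by rewrite /fs_scale /= mulrDr; constructor.
- by rewrite /fs_scale /= mulrCA; constructor.
Qed.

Lemma pi_bc_add t u :
  bc_add (\pi_base_change t) (\pi_base_change u) = \pi_base_change (t ++ u).
Proof. by apply/base_changeP/tensor_cat; apply: repr_tensor_eq. Qed.

Lemma pi_bc_opp t : bc_opp (\pi_base_change t) = \pi_base_change (fs_opp t).
Proof. exact/base_changeP/fs_opp_eq/repr_tensor_eq. Qed.

Lemma pi_bc_scale a t :
  bc_scale a (\pi_base_change t) = \pi_base_change (fs_scale a t).
Proof. exact/base_changeP/fs_scale_eq/repr_tensor_eq. Qed.

Lemma bc_addA : associative bc_add.
Proof.
move=> p q r; elim/base_change_ind: p => t; elim/base_change_ind: q => u; elim/base_change_ind: r => v.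
by rewrite !pi_bc_add catA.
Qed.

Lemma bc_addC : commutative bc_add.
Proof.
move=> p q; elim/base_change_ind: p => t; elim/base_change_ind: q => u.
by rewrite !pi_bc_add; apply/base_changeP/tensor_catC.
Qed.

Lemma bc_add0 : left_id (\pi_base_change [::]) bc_add.
Proof. by move=> p; elim/base_change_ind: p => t; rewrite pi_bc_add. Qed.

Lemma bc_addN : left_inverse (\pi_base_change [::]) bc_opp bc_add.
Proof.
move=> p; elim/base_change_ind: p => t; rewrite pi_bc_opp pi_bc_add; apply/base_changeP.
elim: t => [|[x s] t IH]; first by constructor.
have hxs : tensor_eq [:: (- x, s); (x, s)] [::].
  apply: tensor_trans (tensor_0l s); apply: tensor_sym.
  by rewrite -{1}(addNr x); constructor.
have -> : fs_opp ((x, s) :: t) ++ (x, s) :: t =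
    [:: (- x, s)] ++ ((fs_opp t ++ [:: (x, s)]) ++ t) by rewrite -catA.
apply: (@tensor_trans _ ([:: (- x, s)] ++ (([:: (x, s)] ++ fs_opp t) ++ t))).
  apply: tensor_cat; first exact: tensor_refl.
  by apply: tensor_cat; [exact: tensor_catC | exact: tensor_refl].
by rewrite -catA; exact: (tensor_cat hxs IH).
Qed.

HB.instance Definition _ :=
  GRing.isZmodule.Build base_change bc_addA bc_addC bc_add0 bc_addN.

Lemma bc_scaleA a b p : bc_scale a (bc_scale b p) = bc_scale (a * b) p.
Proof.
elim/base_change_ind: p => t; rewrite !pi_bc_scale /fs_scale -map_comp.
by congr (\pi_base_change _); apply: eq_map => -[x s] /=; rewrite mulrA.
Qed.

Lemma bc_scale1 : left_id 1 bc_scale.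
Proof.
move=> p; elim/base_change_ind: p => t; rewrite pi_bc_scale; congr (\pi_base_change _).
by rewrite -[RHS]map_id; apply: eq_map => -[x s] /=; rewrite mul1r.
Qed.

Lemma bc_scaleDr : right_distributive bc_scale +%R.
Proof.
move=> a p q; elim/base_change_ind: p => t; elim/base_change_ind: q => u.
change (bc_scale a (bc_add (\pi t) (\pi u)) =
        bc_add (bc_scale a (\pi t)) (bc_scale a (\pi u))).
by rewrite pi_bc_add !pi_bc_scale pi_bc_add /fs_scale map_cat.
Qed.

Lemma bc_scaleDl p : {morph bc_scale^~ p : a b / a + b}.
Proof.
move=> a b; elim/base_change_ind: p => t.
change (bc_scale (a + b) (\pi t) =
        bc_add (bc_scale a (\pi t)) (bc_scale b (\pi t))).
rewrite !pi_bc_scale pi_bc_add; apply/base_changeP.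
elim: t => [|[x s] t IH]; first by constructor.
have h : tensor_eq [:: (x, (a + b) * s)] ([:: (x, a * s)] ++ [:: (x, b * s)]).
  by rewrite mulrDl; constructor.
apply: tensor_trans (tensor_cat h IH) _; rewrite -catA.
rewrite [X in tensor_eq _ X](_ : _ = [:: (x, a * s)] ++
  ((fs_scale a t ++ [:: (x, b * s)]) ++ fs_scale b t)); last by rewrite -catA.
apply: tensor_cat; first exact: tensor_refl.
rewrite catA; apply: tensor_cat; last exact: tensor_refl.
exact: tensor_catC.
Qed.

HB.instance Definition _ := GRing.Zmodule_isLmodule.Build S base_change
  bc_scaleA bc_scale1 bc_scaleDr bc_scaleDl.

End BaseChange.

(* The I-adic completion: I-adic Cauchy sequences modulo null sequences. *)
Section Completion.
Variables (R : comPzRingType) (I : set R).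

Definition adic_cauchy (u : nat -> R) : Prop :=
  forall n, exists k, forall i j, (k <= i)%N -> (k <= j)%N ->
    ideal_pow I n (u i - u j).

Definition adic_null (u : nat -> R) : Prop :=
  forall n, exists k, forall i, (k <= i)%N -> ideal_pow I n (u i).

Definition adic_cauchy_pred : {pred nat -> R} :=
  [pred u : nat -> R | `[< adic_cauchy u >]].

Lemma adic_cauchy_subring : subring_closed adic_cauchy_pred.
Proof.
split.
- apply/asboolP => n; exists 0%N => i j _ _.
  rewrite -[X in ideal_pow I n X]/(1 - 1 : R) subrr; exact: ideal_pow0.
- move=> u v /asboolP hu /asboolP hv; apply/asboolP => n.
  have [k hk] := hu n; have [l hl] := hv n.
  exists (maxn k l) => i j; rewrite !geq_max => /andP[ki li] /andP[kj lj].
  rewrite -[X in ideal_pow I n X]/((u i - v i) - (u j - v j)).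
  have -> : u i - v i - (u j - v j) = (u i - u j) + - (v i - v j).
    by rewrite [- (u j - _)]opprD [- (v i - _)]opprD addrACA.
  by apply: ideal_powD; [apply: hk | apply/ideal_powN/hl].
- move=> u v /asboolP hu /asboolP hv; apply/asboolP => n.
  have [k hk] := hu n; have [l hl] := hv n.
  exists (maxn k l) => i j; rewrite !geq_max => /andP[ki li] /andP[kj lj].
  rewrite -[X in ideal_pow I n X]/(u i * v i - u j * v j).
  have -> : u i * v i - u j * v j = u i * (v i - v j) + v j * (u i - u j).
    by rewrite !mulrBr addrA [v j * u i]mulrC subrK [v j * _]mulrC.
  by apply: ideal_powD; apply: ideal_powM; [apply: hl | apply: hk].
Qed.

HB.instance Definition _ := GRing.isSubringClosed.Build (nat -> R)
  adic_cauchy_pred adic_cauchy_subring.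

Record cauchy_seq :=
  CauchySeq { cauchy_val :> nat -> R; _ : cauchy_val \in adic_cauchy_pred }.

HB.instance Definition _ := [isSub for cauchy_val].
HB.instance Definition _ := [Choice of cauchy_seq by <:].
HB.instance Definition _ := GRing.SubChoice_isSubComPzRing.Build
  (nat -> R) adic_cauchy_pred cauchy_seq adic_cauchy_subring.

Lemma cauchy_valD (u v : cauchy_seq) :
  cauchy_val (u + v) = cauchy_val u + cauchy_val v.
Proof. exact: (raddfD (val : cauchy_seq -> (nat -> R))). Qed.

Lemma cauchy_valN (u : cauchy_seq) : cauchy_val (- u) = - cauchy_val u.
Proof. exact: (raddfN (val : cauchy_seq -> (nat -> R))). Qed.

Lemma cauchy_valM (u v : cauchy_seq) :
  cauchy_val (u * v) = cauchy_val u * cauchy_val v.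
Proof. exact: (rmorphM (val : cauchy_seq -> (nat -> R))). Qed.

Lemma adic_nullD u v : adic_null u -> adic_null v -> adic_null (u + v).
Proof.
move=> hu hv n; have [k hk] := hu n; have [l hl] := hv n.
exists (maxn k l) => i; rewrite geq_max => /andP[ki li].
by rewrite -[X in ideal_pow I n X]/(u i + v i); apply: ideal_powD; auto.
Qed.

Lemma adic_nullM u v : adic_null v -> adic_null (u * v).
Proof.
move=> hv n; have [k hk] := hv n; exists k => i ki.
by rewrite -[X in ideal_pow I n X]/(u i * v i); apply: ideal_powM; auto.
Qed.

Lemma adic_nullN u : adic_null u -> adic_null (- u).
Proof. by rewrite -mulN1r; apply: adic_nullM. Qed.

Lemma adic_null0 : adic_null 0.
Proof. by move=> n; exists 0%N => i _; apply: ideal_pow0. Qed.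

Definition cauchy_eqb (u v : cauchy_seq) : bool :=
  `[< adic_null (cauchy_val u - cauchy_val v) >].

Lemma cauchy_eqb_equiv : equiv_class_of cauchy_eqb.
Proof.
split.
- by move=> u; apply/asboolP; rewrite subrr; apply: adic_null0.
- by move=> u v; apply/asboolP/asboolP => /adic_nullN; rewrite opprB.
- move=> v u w /asboolP uv /asboolP vw; apply/asboolP.
  by have := adic_nullD uv vw; rewrite addrA subrK.
Qed.

Canonical cauchy_equiv := EquivRelPack cauchy_eqb_equiv.

Definition completion := {eq_quot cauchy_equiv}.
HB.instance Definition _ := Choice.on completion.
HB.instance Definition _ := EqQuotient.on completion.

Lemma completionP (u v : cauchy_seq) :
  \pi_completion u = \pi_completion v <->
  adic_null (cauchy_val u - cauchy_val v).
Proof. by split=> [/eqmodP/asboolP|h]; last exact/eqmodP/asboolP. Qed.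

Lemma completion_ind (P : completion -> Prop) :
  (forall u, P (\pi_completion u)) -> forall p, P p.
Proof. by move=> h p; rewrite -[p]reprK. Qed.

Definition cpl_add (p q : completion) : completion :=
  \pi_completion (repr p + repr q).
Definition cpl_opp (p : completion) : completion := \pi_completion (- repr p).
Definition cpl_mul (p q : completion) : completion :=
  \pi_completion (repr p * repr q).

Lemma repr_cpl u : adic_null (cauchy_val (repr (\pi_completion u)) - cauchy_val u).
Proof. by apply/completionP; rewrite reprK. Qed.

Lemma pi_cpl_add u v :
  cpl_add (\pi_completion u) (\pi_completion v) = \pi_completion (u + v).
Proof.
apply/completionP; rewrite !cauchy_valD opprD addrACA.
by apply: adic_nullD; apply: repr_cpl.
Qed.

Lemma pi_cpl_opp u : cpl_opp (\pi_completion u) = \pi_completion (- u).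
Proof.
apply/completionP; rewrite !cauchy_valN -opprD.
exact/adic_nullN/repr_cpl.
Qed.

Lemma pi_cpl_mul u v :
  cpl_mul (\pi_completion u) (\pi_completion v) = \pi_completion (u * v).
Proof.
apply/completionP; rewrite !cauchy_valM.
set u' := cauchy_val (repr _); set v' := cauchy_val (repr _).
have -> : u' * v' - cauchy_val u * cauchy_val v =
    u' * (v' - cauchy_val v) + cauchy_val v * (u' - cauchy_val u).
  by rewrite !mulrBr addrA [cauchy_val v * u']mulrC subrK [cauchy_val v * _]mulrC.
by apply: adic_nullD; apply: adic_nullM; apply: repr_cpl.
Qed.

Lemma cpl_addA : associative cpl_add.
Proof.
move=> p q r; elim/completion_ind: p => u; elim/completion_ind: q => v.
by elim/completion_ind: r => w; rewrite !pi_cpl_add addrA.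
Qed.

Lemma cpl_addC : commutative cpl_add.
Proof. by move=> p q; rewrite /cpl_add addrC. Qed.

Lemma cpl_add0 : left_id (\pi_completion 0) cpl_add.
Proof. by move=> p; elim/completion_ind: p => u; rewrite pi_cpl_add add0r. Qed.

Lemma cpl_addN : left_inverse (\pi_completion 0) cpl_opp cpl_add.
Proof.
by move=> p; elim/completion_ind: p => u; rewrite pi_cpl_opp pi_cpl_add addNr.
Qed.

HB.instance Definition _ :=
  GRing.isZmodule.Build completion cpl_addA cpl_addC cpl_add0 cpl_addN.

Lemma cpl_mulA : associative cpl_mul.
Proof.
move=> p q r; elim/completion_ind: p => u; elim/completion_ind: q => v.
by elim/completion_ind: r => w; rewrite !pi_cpl_mul mulrA.
Qed.

Lemma cpl_mulC : commutative cpl_mul.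
Proof. by move=> p q; rewrite /cpl_mul mulrC. Qed.

Lemma cpl_mul1 : left_id (\pi_completion 1) cpl_mul.
Proof. by move=> p; elim/completion_ind: p => u; rewrite pi_cpl_mul mul1r. Qed.

Lemma cpl_mulDl : left_distributive cpl_mul +%R.
Proof.
move=> p q r; elim/completion_ind: p => u; elim/completion_ind: q => v.
elim/completion_ind: r => w.
change (cpl_mul (cpl_add (\pi u) (\pi v)) (\pi w) =
        cpl_add (cpl_mul (\pi u) (\pi w)) (cpl_mul (\pi v) (\pi w))).
by rewrite pi_cpl_add !pi_cpl_mul pi_cpl_add mulrDl.
Qed.

HB.instance Definition _ := GRing.Zmodule_isComPzRing.Build completion
  cpl_mulA cpl_mulC cpl_mul1 cpl_mulDl.

Lemma cst_cauchy (a : R) : (fun=> a) \in adic_cauchy_pred.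
Proof.
by apply/asboolP => n; exists 0%N => i j _ _; rewrite subrr; apply: ideal_pow0.
Qed.

Definition to_completion (a : R) : completion :=
  \pi_completion (CauchySeq (cst_cauchy a)).

Lemma to_completion_zmod : zmod_morphism to_completion.
Proof.
move=> a b; change (to_completion (a - b) =
  cpl_add (to_completion a) (cpl_opp (to_completion b))).
by rewrite pi_cpl_opp pi_cpl_add; congr (\pi_completion _); apply: val_inj.
Qed.

Lemma to_completion_monoid : monoid_morphism to_completion.
Proof.
split; first by congr (\pi_completion _); apply: val_inj.
move=> a b; change (to_completion (a * b) =
  cpl_mul (to_completion a) (to_completion b)).
by rewrite pi_cpl_mul; congr (\pi_completion _); apply: val_inj.
Qed.

HB.instance Definition _ := GRing.isZmodMorphism.Build R completion to_completion
  to_completion_zmod.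
HB.instance Definition _ := GRing.isMonoidMorphism.Build R completion to_completion
  to_completion_monoid.

End Completion.

(* The total quotient ring: fractions whose denominator is a nonzerodivisor
   (for a commutative ring, [GRing.lreg]). *)
Section TotalQuotientRing.
Variable S : comPzRingType.

Record fraction_pair := FractionPair {
  fp_val :> S * S; _ : `[< GRing.lreg fp_val.2 >] }.

HB.instance Definition _ := [isSub for fp_val].
HB.instance Definition _ := [Choice of fraction_pair by <:].

Definition mk_fp (a s : S) (hs : GRing.lreg s) : fraction_pair :=
  @FractionPair (a, s) (introT (asboolP _) hs).

Lemma fp_reg (x : fraction_pair) : GRing.lreg x.2.
Proof. by case: x => x /= /asboolP. Qed.
Arguments fp_reg : clear implicits.

Definition fp_eqb (x y : fraction_pair) : bool := x.1 * y.2 == y.1 * x.2.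

Lemma fp_eqb_equiv : equiv_class_of fp_eqb.
Proof.
split=> [x|x y|y x z]; rewrite /fp_eqb.
- exact: eqxx.
- exact: eq_sym.
- move=> /eqP xy /eqP yz; apply/eqP; apply: (fp_reg y).
  by rewrite mulrA [y.2 * _]mulrC xy mulrAC yz mulrCA mulrA.
Qed.

Canonical fp_equiv := EquivRelPack fp_eqb_equiv.

Definition total_quotient_ring := {eq_quot fp_equiv}.
Local Notation Q := total_quotient_ring.
HB.instance Definition _ := Choice.on Q.
HB.instance Definition _ := EqQuotient.on Q.

Lemma tqrP (x y : fraction_pair) :
  \pi_Q x = \pi_Q y <-> x.1 * y.2 = y.1 * x.2.
Proof. by split=> [/eqmodP/eqP|h]; last exact/eqmodP/eqP. Qed.

Lemma tqr_ind (P : Q -> Prop) : (forall x, P (\pi_Q x)) -> forall p, P p.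
Proof. by move=> h p; rewrite -[p]reprK. Qed.

Definition fp_of (a : S) : fraction_pair := mk_fp a (@lreg1 S).
Definition fp_add (x y : fraction_pair) : fraction_pair :=
  mk_fp (x.1 * y.2 + y.1 * x.2) (lregM (fp_reg x) (fp_reg y)).
Definition fp_opp (x : fraction_pair) : fraction_pair :=
  mk_fp (- x.1) (fp_reg x).
Definition fp_mul (x y : fraction_pair) : fraction_pair :=
  mk_fp (x.1 * y.1) (lregM (fp_reg x) (fp_reg y)).

Definition tqr_add (p q : Q) : Q := \pi_Q (fp_add (repr p) (repr q)).
Definition tqr_opp (p : Q) : Q := \pi_Q (fp_opp (repr p)).
Definition tqr_mul (p q : Q) : Q := \pi_Q (fp_mul (repr p) (repr q)).
Definition to_tqr (a : S) : Q := \pi_Q (fp_of a).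

Lemma repr_tqr x : (repr (\pi_Q x)).1 * x.2 = x.1 * (repr (\pi_Q x)).2.
Proof. by apply/tqrP; rewrite reprK. Qed.

Lemma pi_tqr_add x y : tqr_add (\pi_Q x) (\pi_Q y) = \pi_Q (fp_add x y).
Proof.
apply/tqrP => /=; have := repr_tqr x; have := repr_tqr y.
move: (repr (\pi_Q x)) (repr (\pi_Q y)) => x' y' hy hx.
rewrite !mulrDl; congr (_ + _).
  by rewrite mulrACA hx [y'.2 * _]mulrC mulrACA.
by rewrite [x.2 * y.2]mulrC mulrACA hy [x'.2 * x.2]mulrC mulrACA [y'.2 * _]mulrC.
Qed.

Lemma pi_tqr_opp x : tqr_opp (\pi_Q x) = \pi_Q (fp_opp x).
Proof. by apply/tqrP => /=; rewrite !mulNr repr_tqr. Qed.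

Lemma pi_tqr_mul x y : tqr_mul (\pi_Q x) (\pi_Q y) = \pi_Q (fp_mul x y).
Proof. by apply/tqrP => /=; rewrite mulrACA !repr_tqr mulrACA. Qed.

Lemma tqr_addA : associative tqr_add.
Proof.
move=> p q r; elim/tqr_ind: p => x; elim/tqr_ind: q => y; elim/tqr_ind: r => z.
rewrite !pi_tqr_add; congr (\pi_Q _); apply: val_inj; congr (_, _) => /=.
  rewrite !mulrDl -!addrA; congr (_ + (_ + _)).
  - by rewrite mulrA.
  - by rewrite mulrAC.
  - by rewrite -mulrA [y.2 * _]mulrC.
by rewrite mulrA.
Qed.

Lemma tqr_addC : commutative tqr_add.
Proof.
move=> p q; elim/tqr_ind: p => x; elim/tqr_ind: q => y; rewrite !pi_tqr_add.
by apply/tqrP => /=; rewrite addrC [x.2 * _]mulrC.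
Qed.

Lemma tqr_add0 : left_id (to_tqr 0) tqr_add.
Proof.
move=> p; elim/tqr_ind: p => x; rewrite pi_tqr_add.
by apply/tqrP => /=; rewrite mul0r add0r mulr1 mul1r.
Qed.

Lemma tqr_addN : left_inverse (to_tqr 0) tqr_opp tqr_add.
Proof.
move=> p; elim/tqr_ind: p => x; rewrite pi_tqr_opp pi_tqr_add.
by apply/tqrP => /=; rewrite mulNr addNr !mul0r.
Qed.

HB.instance Definition _ :=
  GRing.isZmodule.Build Q tqr_addA tqr_addC tqr_add0 tqr_addN.

Lemma tqr_mulA : associative tqr_mul.
Proof.
move=> p q r; elim/tqr_ind: p => x; elim/tqr_ind: q => y; elim/tqr_ind: r => z.
by rewrite !pi_tqr_mul; apply/tqrP => /=; rewrite !mulrA.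
Qed.

Lemma tqr_mulC : commutative tqr_mul.
Proof.
move=> p q; elim/tqr_ind: p => x; elim/tqr_ind: q => y; rewrite !pi_tqr_mul.
by apply/tqrP => /=; rewrite [x.1 * _]mulrC [x.2 * _]mulrC.
Qed.

Lemma tqr_mul1 : left_id (to_tqr 1) tqr_mul.
Proof.
move=> p; elim/tqr_ind: p => x; rewrite pi_tqr_mul.
by apply/tqrP => /=; rewrite !mul1r.
Qed.

Lemma tqr_mulDl : left_distributive tqr_mul +%R.
Proof.
move=> p q r; elim/tqr_ind: p => x; elim/tqr_ind: q => y; elim/tqr_ind: r => z.
change (tqr_mul (tqr_add (\pi x) (\pi y)) (\pi z) =
        tqr_add (tqr_mul (\pi x) (\pi z)) (tqr_mul (\pi y) (\pi z))).
rewrite pi_tqr_add !pi_tqr_mul pi_tqr_add; apply/tqrP => /=.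
rewrite [x.1 * z.1 * _]mulrACA [y.1 * z.1 * _]mulrACA -mulrDl.
rewrite [x.2 * z.2 * _]mulrACA -!mulrA; congr (_ * (_ * _)).
by rewrite [RHS]mulrCA; congr (_ * _); rewrite [RHS]mulrCA.
Qed.

HB.instance Definition _ := GRing.Zmodule_isComPzRing.Build Q
  tqr_mulA tqr_mulC tqr_mul1 tqr_mulDl.

Lemma to_tqr_zmod : zmod_morphism to_tqr.
Proof.
move=> a b; change (to_tqr (a - b) = tqr_add (to_tqr a) (tqr_opp (to_tqr b))).
by rewrite pi_tqr_opp pi_tqr_add; apply/tqrP => /=; rewrite !mulr1.
Qed.

Lemma to_tqr_monoid : monoid_morphism to_tqr.
Proof.
split=> // a b; change (to_tqr (a * b) = tqr_mul (to_tqr a) (to_tqr b)).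
by rewrite pi_tqr_mul; apply/tqrP => /=; rewrite !mulr1.
Qed.

HB.instance Definition _ := GRing.isZmodMorphism.Build S Q to_tqr to_tqr_zmod.
HB.instance Definition _ := GRing.isMonoidMorphism.Build S Q to_tqr to_tqr_monoid.

End TotalQuotientRing.

Definition extended_from (R S : comPzRingType) (phi : {rmorphism R -> S})
    (N : lmodType S) (X : lmodType R) : Prop :=
  isomorphic N (base_change phi X).

(* Main.v *)
Require Import Defs.
From HB Require Import structures.
From mathcomp Require Import all_boot all_algebra.
From mathcomp Require Import boolp classical_sets functions cardinality fsbigop.

(** Write S for the completion of R, T for its total quotient ring, and let r
    be a nonzero element of the maximal ideal.

    Dimension one makes every nonzero ideal of R contain a power of the maximal
    ideal, so the adic topology is defined by the principal ideals of nonzero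
    elements.  Hence, for every nonzero d, S = R + dS, dS meets R in dR, and d
    stays regular in S ([completion_dense]).  From these facts alone, by elimination over R, one
    gets that S is flat and faithfully flat over R, in the equational form of
    [dense_flat_tensor] and [dense_faithful].  The remaining property of S is
    that a regular element divides a power of r ([completion_reg_divides]), so
    that T = S[1/r]; it rests on the Artinian ring R/rR and on completeness.

    An extended module becomes free over T because the module it comes from
    becomes free over the field of fractions of R ([extended_free]).

    Conversely, a basis of the tensor product of N with T spans, over the field
    of fractions of R, a subspace V.  Since N has no torsion it embeds in that
    tensor product, and X = N \cap V is an R-module with S \otimes X = N: it
    generates N because a division by r can be absorbed in X, thanks to
    S = R + rS, and no relations over S appear in it by flatness
    ([free_extended]).  This is descent along the square formed by R, S, the
    field of fractions of R, and T.

    There remains to see that X is a direct summand of a direct sum of copies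
    of M as soon as S \otimes X is one of copies of S \otimes M
    ([Add_descent]).  This is descent of projectivity for countably generated
    modules, in the style of Raynaud and Gruson.  Write X as an increasing
    union of finitely generated submodules X_n.  Over S, the identity of X_n
    factors through finitely many copies of S \otimes M.  A homomorphism over S
    out of a finitely generated module is an S-combination of homomorphisms
    over R ([semilinear_descent]); so the identity of X_n is an S-combination
    of composites over R, and by faithful flatness an R-combination of them
    ([splits_stage_exists]).  The composites are defined on finite stages only,
    but the same factorizations provide a Mittag-Leffler condition, which
    extends them to X ([stage_map_extends]).  So every element of X is fixed by
    an endomorphism that factors through finitely many copies of M, and a
    telescoping argument over a countable set of generators turns this into a
    splitting of a map from a direct sum of copies of M
    ([locally_split_in_Add]). *)

Set Implicit Arguments.
Unset Strict Implicit.
Unset Printing Implicit Defensive.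

Import GRing.Theory.
Local Open Scope classical_set_scope.
Local Open Scope ring_scope.

(** * Row kernels over a dense extension *)

(** The properties of R -> S used for descent: the first three say that S/dS is
    R/dR and that d is regular, for every nonzero d; the last one says, for a
    local ring R, that the extension is faithful. *)
Record dense_extension (R : idomainType) (S : comPzRingType)
    (phi : {rmorphism R -> S}) : Prop := DenseExtension {
  dense_reg : forall d : R, d != 0 -> GRing.lreg (phi d);
  dense_split : forall (d : R) (s : S), d != 0 ->
    exists a t, s = phi a + phi d * t;
  dense_cap : forall (d a : R) (t : S), d != 0 ->
    phi a = phi d * t -> exists b, a = d * b;
  dense_local : forall n (b : nat -> R) (u : nat -> S),
    1 = \sum_(i < n) u i * phi (b i) ->
    exists2 i, (i < n)%N & b i \is a GRing.unit }.

Section Elimination.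
Variables (R : idomainType) (S : comPzRingType) (phi : {rmorphism R -> S}).

(** Gaussian elimination without division.  The columns may be infinite in
    number, and d and B serve all rows s at once: up to the factor d, the rows
    of B generate the row kernel of a over S. *)
Lemma kernel_elimination (L : Type) n (a : nat -> L -> R) :
  exists (d : R) (p : nat) (B : nat -> nat -> R),
  [/\ d != 0, forall q l, \sum_(i < n) B q i * a i l = 0 &
    forall s : nat -> S, (forall l, \sum_(i < n) s i * phi (a i l) = 0) ->
    exists u : nat -> S, forall i, (i < n)%N ->
      phi d * s i = \sum_(q < p) u q * phi (B q i)].
Proof.
elim: n a => [|n IH] a.
  exists 1, 0%N, (fun _ _ => 0); split=> [|q l|s _]; first exact: oner_neq0.
    by rewrite big_ord0.
  by exists (fun=> 0).
have [[l0 c0]|an0] := pselect (exists l, a n l != 0); last first.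
  have {}an0 l : a n l = 0.
    by apply: contrapT => h; apply: an0; exists l; apply/eqP.
  have [d [p [B [d0 Ba Bs]]]] := IH a.
  exists d, p.+1, (fun q i => if (i < n)%N then (if (q < p)%N then B q i else 0)
                              else (q == p)%:R).
  split=> // [q l|s hs].
    rewrite big_ord_recr /= an0 mulr0 addr0.
    have [qp|_] := boolP (q < p)%N.
      by rewrite -[RHS](Ba q l); apply: eq_bigr => i _; rewrite ltn_ord.
    by rewrite big1 // => i _; rewrite ltn_ord mul0r.
  have [|u hu] := Bs s.
    move=> l; have := hs l.
    by rewrite big_ord_recr /= an0 rmorph0 mulr0 addr0.
  exists (fun q => if (q < p)%N then u q else phi d * s n) => i.
  rewrite ltnS leq_eqVlt => /orP[/eqP ->|ilt].
    rewrite big_ord_recr /= !ltnn eqxx rmorph1 mulr1 big1 ?add0r // => q _.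
    by rewrite (ltn_eqF (ltn_ord q)) rmorph0 mulr0.
  rewrite big_ord_recr /= ilt ltnn rmorph0 mulr0 addr0 hu //.
  by apply: eq_bigr => q _; rewrite ltn_ord.
(* The last row has a nonzero entry c in column l0: eliminating that column
   leaves a matrix with one row less. *)
set c := a n l0 in c0.
have [d [p [B [d0 Ba Bs]]]] :=
  IH (fun i l => c * a i l - a i l0 * a n l).
exists (c * d), p, (fun q i => if (i < n)%N then c * B q i
                    else - \sum_(k < n) B q k * a k l0).
split=> [|q l|s hs]; first by rewrite mulf_neq0.
  rewrite big_ord_recr /= ltnn mulNr mulr_suml -sumrB -[RHS](Ba q l).
  apply: eq_bigr => i _; rewrite ltn_ord mulrBr !mulrA.
  by rewrite [c * _]mulrC.
have hs' l : \sum_(i < n) s i * phi (a i l) = - (s n * phi (a n l)).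
  by apply: (addIr (s n * phi (a n l))); rewrite addNr -[RHS](hs l) big_ord_recr.
have [|u hu] := Bs s.
  move=> l; transitivity (phi c * (\sum_(i < n) s i * phi (a i l))
      - (\sum_(i < n) s i * phi (a i l0)) * phi (a n l)).
    rewrite mulr_sumr mulr_suml -sumrB; apply: eq_bigr => i _.
    by rewrite rmorphB !rmorphM mulrBr mulrCA [X in _ - X]mulrA.
  rewrite !hs' mulNr opprK mulrN addrC; apply/eqP; rewrite subr_eq0; apply/eqP.
  by rewrite [s n * phi (a n l0)]mulrC mulrA.
exists u => i; rewrite ltnS leq_eqVlt => /orP[/eqP ->|ilt]; rewrite rmorphM.
  have -> : phi c * phi d * s n = - (\sum_(i < n) s i * phi (a i l0)) * phi d.
    by rewrite hs' opprK mulrAC [_ * s n]mulrC.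
  rewrite ltnn.
  rewrite mulNr mulr_suml.
  under [RHS]eq_bigr do rewrite rmorphN mulrN.
  rewrite sumrN; congr (- _).
  transitivity (\sum_(k < n) \sum_(q < p) u q * phi (B q k) * phi (a k l0)).
    by apply: eq_bigr => k _; rewrite -mulr_suml -hu // mulrC mulrA.
  rewrite exchange_big; apply: eq_bigr => q _ /=.
  rewrite rmorph_sum mulr_sumr; apply: eq_bigr => k _.
  by rewrite rmorphM mulrA.
rewrite ilt -mulrA hu // mulr_sumr; apply: eq_bigr => q _.
by rewrite rmorphM mulrCA.
Qed.

End Elimination.

Section Flat.
Variables (R : idomainType) (S : comPzRingType) (phi : {rmorphism R -> S}).
Hypothesis dphi : dense_extension phi.

(** Flatness, in equational form.  Elimination gives the factorization for d s;
    writing the coefficients u as elements of R modulo d, the part outside dS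
    is an R-row divisible by d, and its quotient by d is one more row of B. *)
Lemma dense_flat (L : Type) n (a : nat -> L -> R) (s : nat -> S) :
  (forall l, \sum_(i < n) s i * phi (a i l) = 0) ->
  exists (p : nat) (B : nat -> nat -> R) (u : nat -> S),
    (forall q l, (q < p)%N -> \sum_(i < n) B q i * a i l = 0) /\
    (forall i, (i < n)%N -> s i = \sum_(q < p) u q * phi (B q i)).
Proof.
move=> hs.
have [d [p [B [d0 Ba Bs]]]] := kernel_elimination phi n a.
have [u hu] := Bs s hs.
have /choice[ct hct] : forall q, exists ct : R * S, u q = phi ct.1 + phi d * ct.2.
  move=> q; by have [c [t ->]] := dense_split dphi (u q) d0; exists (c, t).
have /choice[b hb] : forall i : nat, exists bi, (i < n)%N ->
    \sum_(q < p) (ct q).1 * B q i = d * bi.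
  move=> i.
  have [ilt|_] := boolP (i < n)%N; last by exists 0.
  have /(dense_cap dphi d0)[b ->] : phi (\sum_(q < p) (ct q).1 * B q i) =
      phi d * (s i - \sum_(q < p) (ct q).2 * phi (B q i)); last by exists b.
    rewrite mulrBr hu // mulr_sumr -sumrB rmorph_sum; apply: eq_bigr => q _.
    by rewrite hct mulrDl mulrA addrK rmorphM.
have sE i : (i < n)%N -> s i = \sum_(q < p) (ct q).2 * phi (B q i) + phi (b i).
  move=> ilt; apply: (dense_reg dphi d0); rewrite hu // mulrDr -rmorphM -hb //.
  rewrite mulr_sumr rmorph_sum -big_split; apply: eq_bigr => q _ /=.
  by rewrite {1}hct mulrDl mulrA addrC rmorphM.
exists p.+1, (fun q i => if (q < p)%N then B q i else b i),
  (fun q => if (q < p)%N then (ct q).2 else 1); split.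
  move=> q l; rewrite ltnS leq_eqVlt => /orP[/eqP ->|qlt]; last first.
    by rewrite qlt Ba.
  rewrite ltnn; apply: (mulfI d0); rewrite mulr0 mulr_sumr.
  transitivity (\sum_(i < n) \sum_(q < p) (ct q).1 * (B q i * a i l)).
    apply: eq_bigr => i _; rewrite mulrA -hb // mulr_suml.
    by apply: eq_bigr => ? _; rewrite mulrA.
  by rewrite exchange_big big1 // => k _; rewrite -mulr_sumr Ba mulr0.
move=> i ilt; rewrite big_ord_recr /= ltnn mul1r sE //; congr (_ + _).
by apply: eq_bigr => q _; rewrite ltn_ord.
Qed.

End Flat.

(** Substitute for a Noetherian argument: the columns span a space of dimension
    at most n over the field of fractions, and torsion-free modules do not see
    the denominators. *)
Lemma finite_rank_relations (R : idomainType) (L : Type) n (a : nat -> L -> R) :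
  exists ls : seq {classic L}, forall (H : lmodType R) (s : nat -> H), torsion_free H ->
    (forall l : {classic L}, l \in ls -> \sum_(i < n) a i l *: s i = 0) ->
    forall l, \sum_(i < n) a i l *: s i = 0.
Proof.
elim: n a => [|n IH] a; first by exists [::] => H s _ _ l; rewrite big_ord0.
have [[l0 c0]|an0] := pselect (exists l, a n l != 0); last first.
  have {}an0 l : a n l = 0.
    by apply: contrapT => h; apply: an0; exists l; apply/eqP.
  have [ls hls] := IH a; exists ls => H s tf hs l.
  rewrite big_ord_recr /= an0 scale0r addr0; apply: hls => // k /hs.
  by rewrite big_ord_recr /= an0 scale0r addr0.
set c := a n l0 in c0.
have [ls hls] := IH (fun i l => c * a i l - a i l0 * a n l).
exists (l0 :: ls) => H s tf hs l.
have E k : \sum_(i < n) (c * a i k - a i l0 * a n k) *: s i =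
    c *: (\sum_(i < n.+1) a i k *: s i).
  have := hs l0 (mem_head _ _); rewrite big_ord_recr /= => /eqP.
  rewrite addr_eq0 => /eqP h0.
  under eq_bigr do rewrite scalerBl.
  rewrite sumrB [in RHS]big_ord_recr /= scalerDr; congr (_ + _).
    by rewrite scaler_sumr; apply: eq_bigr => i _; rewrite scalerA.
  under eq_bigr do rewrite mulrC -scalerA; rewrite -scaler_sumr h0.
  by rewrite scalerN opprK !scalerA mulrC.
have /tf[] : c *: (\sum_(i < n.+1) a i l *: s i) = 0; last by [].
  rewrite -E; apply: hls => // k lk.
  by rewrite E hs ?scaler0 // inE lk orbT.
by move=> c00; rewrite c00 eqxx in c0.
Qed.

(** * Semilinear maps and base change *)

Lemma bundle_linear (R : pzRingType) (V W : lmodType R) (f : V -> W) :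
  linear f -> exists F : {linear V -> W}, forall x, F x = f x.
Proof.
move=> lin_f.
pose F := HB.pack_for {linear V -> W} f (GRing.isLinear.Build R V W *:%R f lin_f).
by exists F.
Qed.

Section Semilinear.
Variables (R S : comPzRingType) (phi : {rmorphism R -> S}).
Variables (X : lmodType R) (Y : lmodType S).

Definition semilinear_map (f : X -> Y) : Prop :=
  forall a x y, f (a *: x + y) = phi a *: f x + f y.

Variables (f : X -> Y) (fS : semilinear_map f).

Lemma semilinearD x y : f (x + y) = f x + f y.
Proof. by have := fS 1 x y; rewrite rmorph1 !scale1r. Qed.

Lemma semilinear0 : f 0 = 0.
Proof. by apply: (addrI (f 0)); rewrite -semilinearD !addr0. Qed.

Lemma semilinearZ a x : f (a *: x) = phi a *: f x.
Proof. by rewrite -[a *: x]addr0 fS semilinear0 addr0. Qed.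

Lemma semilinearN x : f (- x) = - f x.
Proof. by rewrite -scaleN1r semilinearZ rmorphN1 scaleN1r. Qed.

Lemma semilinear_sum I (r : seq I) P F :
  f (\sum_(i <- r | P i) F i) = \sum_(i <- r | P i) f (F i).
Proof. by rewrite (big_morph f semilinearD semilinear0). Qed.

End Semilinear.

Section BaseChangeTheory.
Variables (R S : comPzRingType) (phi : {rmorphism R -> S}) (X : lmodType R).
Local Notation "x ⊗ s" := (tensor phi x s) (at level 40).
Local Notation pi := (\pi_(base_change phi X))%qT.

Lemma tensor_addl (x y : X) s : (x + y) ⊗ s = x ⊗ s + y ⊗ s.
Proof.
change ((x + y) ⊗ s = bc_add (x ⊗ s) (y ⊗ s)).
by rewrite pi_bc_add; apply/base_changeP; constructor.
Qed.

Lemma scale_tensor a (x : X) s : a *: (x ⊗ s) = x ⊗ (a * s).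
Proof.
change (bc_scale a (x ⊗ s) = x ⊗ (a * s)).
by rewrite pi_bc_scale.
Qed.

Lemma tensorE (x : X) s : x ⊗ s = s *: (x ⊗ 1).
Proof. by rewrite scale_tensor mulr1. Qed.

Lemma tensor_semilinear : semilinear_map phi (fun x : X => x ⊗ 1).
Proof.
move=> a x y; rewrite tensor_addl scale_tensor; congr (_ + _).
by apply/base_changeP; constructor.
Qed.

Lemma pi_formal_sum (t : formal_sum S X) :
  \pi_(base_change phi X)%qT t = \sum_(p <- t) p.1 ⊗ p.2.
Proof.
elim: t => [|[x s] t IH]; first by rewrite big_nil.
rewrite big_cons -IH /= -[_ :: t]cat1s -pi_bc_add; by [].
Qed.

Lemma base_change_sum (p : base_change phi X) :
  exists n (x : nat -> X) (s : nat -> S), p = \sum_(i < n) s i *: (x i ⊗ 1).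
Proof.
elim/base_change_ind: p => t; rewrite pi_formal_sum.
exists (size t), (fun i => (nth (0, 0) t i).1), (fun i => (nth (0, 0) t i).2).
rewrite (big_nth (0, 0)) big_mkord.
by apply: eq_bigr => i _; rewrite [LHS]tensorE.
Qed.

Lemma base_change_lift (Y : lmodType S) (f : X -> Y) : semilinear_map phi f ->
  exists F : {linear base_change phi X -> Y},
    forall x s, F (s *: (x ⊗ 1)) = s *: f x.
Proof.
move=> fS; pose ev (t : formal_sum S X) : Y := \sum_(p <- t) p.2 *: f p.1.
have ev_eq t u : tensor_eq phi t u -> ev t = ev u.
  elim=> {t u} //= [t u v _ -> _ -> //|t t' u u' _ h _ h'|t u|s|x y s|x s s'|a x s];
  rewrite /ev ?big_cat ?big_cons ?big_nil /= ?addr0.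
  - by congr (_ + _).
  - by rewrite addrC.
  - by rewrite (semilinear0 fS) scaler0.
  - by rewrite (semilinearD fS) scalerDr.
  - by rewrite scalerDl.
  - by rewrite (semilinearZ fS) scalerA mulrC.
have lin : linear (fun p : base_change phi X => ev (repr p)).
  move=> a p q; elim/base_change_ind: p => t; elim/base_change_ind: q => u.
  change (ev (repr (bc_add (bc_scale a (\pi_(base_change phi X)%qT t)) (\pi_(base_change phi X)%qT u)))
   = a *: ev (repr (\pi_(base_change phi X)%qT t)) + ev (repr (\pi_(base_change phi X)%qT u))).
  rewrite pi_bc_scale pi_bc_add !(ev_eq _ _ (repr_tensor_eq phi _)).
  rewrite /ev big_cat /= big_map scaler_sumr; congr (_ + _).
  by apply: eq_bigr => p _ /=; rewrite scalerA.
have [F FE] := bundle_linear lin.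
exists F => x s; rewrite scale_tensor mulr1 FE (ev_eq _ _ (repr_tensor_eq phi _)).
by rewrite /ev big_seq1.
Qed.

(** The tensor product is the quotient of the free S-module on X by the
    S-span of the R-linear relations of X.  Testing against arbitrary functions
    g avoids building that free module: g is the evaluation of its basis. *)
Lemma tensor_eq_relations (t u : formal_sum S X) : tensor_eq phi t u ->
  exists L : seq (S * seq (X * R)),
    (forall cz, cz \in L -> \sum_(p <- cz.2) p.2 *: p.1 = 0) /\
    forall g : X -> S, \sum_(p <- t) p.2 * g p.1 - \sum_(p <- u) p.2 * g p.1 =
      \sum_(cz <- L) cz.1 * \sum_(p <- cz.2) phi p.2 * g p.1.
Proof.
have rel1 c (z : seq (X * R)) : \sum_(p <- z) p.2 *: p.1 = 0 ->
    forall cz : S * seq (X * R), cz \in [:: (c, z)] -> \sum_(p <- cz.2) p.2 *: p.1 = 0.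
  by move=> z0 cz; rewrite inE => /eqP ->.
elim=> {t u} [t|t u _ [L [L0 Lg]]|t u v _ [L [L0 Lg]] _ [L' [L'0 L'g]]
  |t t' u u' _ [L [L0 Lg]] _ [L' [L'0 L'g]]|t u|s|x y s|x s s'|a x s].
- by exists [::]; split=> // g; rewrite subrr big_nil.
- exists [seq (- cz.1, cz.2) | cz <- L]; split=> [cz /mapP[cz' /L0 h ->]|g] //.
  rewrite -opprB Lg big_map -sumrN.
  by apply: eq_bigr => cz _ /=; rewrite mulNr.
- exists (L ++ L'); split=> [cz|g].
    by rewrite mem_cat => /orP[/L0|/L'0].
  by rewrite big_cat /= -Lg -L'g addrA subrK.
- exists (L ++ L'); split=> [cz|g].
    by rewrite mem_cat => /orP[/L0|/L'0].
  by rewrite !big_cat /= -Lg -L'g opprD addrACA.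
- exists [::]; split=> // g.
  by rewrite !big_cat /= big_nil [X in X - _]addrC subrr.
- exists [:: (s, [:: (0, 1)])]; split=> [|g].
    by apply: rel1; rewrite big_seq1 scaler0.
  by rewrite big_nil !big_seq1 /= subr0 rmorph1 mul1r.
- exists [:: (s, [:: (x + y, 1); (x, -1); (y, -1)])]; split=> [|g].
    apply: rel1; rewrite !big_cons big_nil /= addr0 scale1r !scaleN1r.
    by rewrite -opprD subrr.
  rewrite !big_cons !big_nil /= !addr0 rmorph1 rmorphN1 mul1r !mulN1r.
  by rewrite !mulrDr !mulrN opprD.
- exists [::]; split=> // g.
  by rewrite !big_cons !big_nil /= !addr0 mulrDl subrr.
- exists [:: (s, [:: (a *: x, 1); (x, - a)])]; split=> [|g].
    by apply: rel1; rewrite !big_cons big_nil /= addr0 scale1r scaleNr subrr.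
  rewrite !big_cons !big_nil /= !addr0 rmorph1 mul1r rmorphN mulNr mulrBr.
  by rewrite [s * (_ * _)]mulrCA mulrA.
Qed.

End BaseChangeTheory.

Lemma formal_zero (R : pzRingType) (X : lmodType R) (z : seq (X * R)) :
  (forall l : X, \sum_(p <- z) p.2 * (p.1 == l)%:R = 0) ->
  \sum_(p <- z) p.2 *: p.1 = 0.
Proof.
move=> z0; pose U := undup [seq p.1 | p <- z].
transitivity (\sum_(l <- U) (\sum_(p <- z) p.2 * (p.1 == l)%:R) *: l); last first.
  by rewrite big1_seq // => l _; rewrite z0 scale0r.
under [RHS]eq_bigr do rewrite scaler_suml.
rewrite exchange_big /= [LHS]big_seq_cond [RHS]big_seq_cond; apply: eq_bigr => p.
rewrite andbT => pz.
rewrite (bigD1_seq p.1) ?undup_uniq ?mem_undup ?map_f //= eqxx mulr1.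
rewrite big1 ?addr0 // => l; rewrite eq_sym => /negPf ->.
by rewrite mulr0 scale0r.
Qed.

(** * Flatness and faithful flatness *)

Section FlatModules.
Variables (R : idomainType) (S : comPzRingType) (phi : {rmorphism R -> S}).
Hypothesis dphi : dense_extension phi.
Variable X : lmodType R.
Local Notation "x ⊗ s" := (tensor phi x s) (at level 40).

(** The vanishing of the tensor is an equation between an S-combination of
    points of X and an S-combination of relations of X; [dense_flat], with the
    points of X as columns, makes its coefficients combinations of R-solutions,
    and each R-solution is a relation between the x i. *)
Lemma dense_flat_tensor n (x : nat -> X) (s : nat -> S) :
  \sum_(i < n) s i *: (x i ⊗ 1) = 0 ->
  exists (p : nat) (B : nat -> nat -> R) (u : nat -> S),
    (forall q, (q < p)%N -> \sum_(i < n) B q i *: x i = 0) /\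
    (forall i, (i < n)%N -> s i = \sum_(q < p) u q * phi (B q i)).
Proof.
move=> sx0.
have /tensor_eq_relations[L [L0 Lg]] :
    tensor_eq phi [seq (x i, s i) | i <- iota 0 n] [::].
  apply/base_changeP; rewrite !pi_formal_sum big_nil big_map /=.
  rewrite -{1}[n]subn0 -/(index_iota 0 n) big_mkord -[RHS]sx0.
  by apply: eq_bigr => i _; rewrite tensorE.
pose Z i := if (i < n)%N then [:: (x i, 1)] else (nth (0, [::]) L (i - n)).2.
pose s' i := if (i < n)%N then s i else - (nth (0, [::]) L (i - n)).1.
pose a i l : R := \sum_(p <- Z i) p.2 * (p.1 == l)%:R.
have s'a l : \sum_(i < n + size L) s' i * phi (a i l) = 0.
  rewrite big_split_ord /=.
  have := Lg (fun y => phi (y == l)%:R).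
  rewrite big_nil subr0 big_map /= -{1}[n]subn0 -/(index_iota 0 n) big_mkord.
  rewrite (big_nth (0, [::])) big_mkord => h.
  rewrite (_ : \sum_(i < n) _ = \sum_(i < n) s i * phi (x i == l)%:R); last first.
    apply: eq_bigr => i _.
    by rewrite /s' /a /Z ltn_ord big_seq1 mul1r.
  rewrite h -big_split big1 // => i _ /=.
  rewrite /s' /a /Z ltnNge leq_addr addKn mulNr /= rmorph_sum.
  rewrite (_ : \sum_(p <- _) _ = \sum_(p <- (nth (0, [::]) L i).2) phi p.2 * phi (p.1 == l)%:R) ?subrr //.
  by apply: eq_bigr => p _; rewrite rmorphM.
have [p [B [u [Ba su]]]] := dense_flat dphi s'a.
exists p, B, u; split=> [q qp|i ilt]; last first.
  have := su i (leq_trans ilt (leq_addr _ _)).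
  by rewrite {1}/s' ilt.
pose z := flatten [seq [seq (p.1, B q i * p.2) | p <- Z i] | i <- iota 0 (n + size L)].
have zE (V : zmodType) (F : X * R -> V) : \sum_(p <- z) F p =
    \sum_(i < n + size L) \sum_(p <- Z i) F (p.1, B q i * p.2).
  rewrite /z big_flatten big_map -{1}[(_ + _)%N]subn0 -/(index_iota 0 _) big_mkord.
  by apply: eq_bigr => i _; rewrite big_map.
have : \sum_(p <- z) p.2 *: p.1 = 0.
  apply: formal_zero => l; rewrite zE -[RHS](Ba q l qp); apply: eq_bigr => i _.
  by rewrite /a mulr_sumr; apply: eq_bigr => t _ /=; rewrite mulrA.
rewrite zE big_split_ord /= [X in _ + X]big1 ?addr0.
  move=> h; rewrite -[RHS]h; apply: eq_bigr => i _.
  by rewrite /Z ltn_ord big_seq1 /= mulr1.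
move=> i _; rewrite /Z ltnNge leq_addr /= addKn.
transitivity (B q (n + i)%N *: \sum_(t <- (nth (0, [::]) L i).2) t.2 *: t.1).
  by rewrite scaler_sumr; apply: eq_bigr => t _; rewrite scalerA.
by rewrite L0 ?mem_nth // scaler0.
Qed.

Lemma dense_flat_system Q n (x : nat -> nat -> X) (s : nat -> S) :
  (forall f, (f < Q)%N -> \sum_(i < n) s i *: (x f i ⊗ 1) = 0) ->
  exists (p : nat) (B : nat -> nat -> R) (u : nat -> S),
    (forall f q, (f < Q)%N -> (q < p)%N -> \sum_(i < n) B q i *: x f i = 0) /\
    (forall i, (i < n)%N -> s i = \sum_(q < p) u q * phi (B q i)).
Proof.
elim: Q => [|Q IH] hx.
  exists n, (fun q i => (q == i)%:R), s; split=> // i ilt.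
  rewrite (bigD1 (Ordinal ilt)) //= eqxx rmorph1 mulr1 big1 ?addr0 // => q qi.
  by rewrite (_ : _ == _ = false) ?rmorph0 ?mulr0 //; apply: contraNF qi.
have [f fQ|p [B [u [Bx su]]]] := IH; first by apply: hx; rewrite ltnS ltnW.
have : \sum_(q < p) u q *: ((\sum_(i < n) B q i *: x Q i) ⊗ 1) = 0.
  rewrite -[RHS](hx Q (leqnn _)).
  under eq_bigr do rewrite (semilinear_sum (@tensor_semilinear _ _ phi X)) scaler_sumr.
  rewrite exchange_big; apply: eq_bigr => i _ /=; rewrite su // scaler_suml.
  by apply: eq_bigr => q _; rewrite (semilinearZ (@tensor_semilinear _ _ phi X)) scalerA.
move=> /(@dense_flat_tensor p (fun q => \sum_(i < n) B q i *: x Q i) u)[r [C [v [Cy uv]]]].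
exists r, (fun k i => \sum_(q < p) C k q * B q i), v; split; last first.
  move=> i ilt; rewrite su //.
  under eq_bigr do rewrite uv // mulr_suml.
  rewrite exchange_big; apply: eq_bigr => k _ /=.
  rewrite rmorph_sum mulr_sumr; apply: eq_bigr => q _.
  by rewrite rmorphM mulrA.
move=> f k; rewrite ltnS leq_eqVlt => fQ kr.
transitivity (\sum_(q < p) C k q *: \sum_(i < n) B q i *: x f i).
  under eq_bigr do rewrite scaler_suml.
  rewrite exchange_big; apply: eq_bigr => q _ /=.
  by rewrite scaler_sumr; apply: eq_bigr => i _; rewrite scalerA.
case/orP: fQ => [/eqP ->|fQ]; first exact: Cy.
by rewrite big1 // => q _; rewrite Bx // scaler0.
Qed.

(** If w is an S-combination of the e q, flatness describes (1, - u) by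
    R-relations between w and the e q; some relation has a unit coefficient at
    w, because these coefficients generate the unit ideal of S. *)
Lemma dense_faithful Q (w : nat -> X) p (e : nat -> nat -> X) (u : nat -> S) :
  (forall i, (i < Q)%N -> w i ⊗ 1 = \sum_(q < p) u q *: (e q i ⊗ 1)) ->
  exists c : nat -> R, forall i, (i < Q)%N -> w i = \sum_(q < p) c q *: e q i.
Proof.
move=> hw.
have [f fQ|r [B [v [Bx sv]]]] := @dense_flat_system Q p.+1
    (fun f q => if q is q'.+1 then e q' f else w f)
    (fun q => if q is q'.+1 then - u q' else 1).
  rewrite big_ord_recl /= scale1r hw // -big_split big1 //= => q _.
  by rewrite /bump /= scaleNr subrr.
have [k kr Bk] := dense_local dphi (b := fun q => B q 0%N) (sv 0%N isT).
exists (fun q => - (B k 0%N)^-1 * B k q.+1) => i iQ.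
have := Bx i k iQ kr; rewrite big_ord_recl /= => /(congr1 (fun y => (B k 0%N)^-1 *: y)).
rewrite scaler0 scalerDr scalerA mulVr // scale1r => /eqP.
rewrite addr_eq0 => /eqP ->; rewrite scaler_sumr -sumrN; apply: eq_bigr => q _.
by rewrite scalerA mulNr scaleNr.
Qed.

Lemma base_change_torsion_free : torsion_free X ->
  forall (d : R) (z : base_change phi X), d != 0 -> phi d *: z = 0 -> z = 0.
Proof.
move=> tf d z d0; have [n [x [s ->]]] := base_change_sum z => hz.
have [|p [B [u [Bx su]]]] := @dense_flat_tensor n (fun i => d *: x i) s.
  rewrite -[RHS]hz scaler_sumr; apply: eq_bigr => i _.
  by rewrite (semilinearZ (@tensor_semilinear _ _ phi X)) !scalerA mulrC.
transitivity (\sum_(q < p) u q *: ((\sum_(i < n) B q i *: x i) ⊗ 1)).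
  under [RHS]eq_bigr do rewrite (semilinear_sum (@tensor_semilinear _ _ phi X)) scaler_sumr.
  rewrite exchange_big; apply: eq_bigr => i _ /=; rewrite su // scaler_suml.
  by apply: eq_bigr => q _; rewrite (semilinearZ (@tensor_semilinear _ _ phi X)) scalerA.
rewrite big1 // => q _.
have /tf[d00|->] : d *: (\sum_(i < n) B q i *: x i) = 0.
- rewrite -[RHS](Bx q) // scaler_sumr; apply: eq_bigr => i _.
  by rewrite !scalerA mulrC.
- by rewrite d00 eqxx in d0.
by rewrite (semilinear0 (@tensor_semilinear _ _ phi X)) scaler0.
Qed.

End FlatModules.

(** * The total quotient ring *)

Section TotalQuotient.
Variable S : comPzRingType.
Local Notation Q := (total_quotient_ring S).
Local Notation psi := (@to_tqr S : {rmorphism S -> Q}).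

Lemma to_tqr_inj : injective psi.
Proof. by move=> a b /tqrP /=; rewrite !mulr1. Qed.

Lemma tqr_fraction (q : Q) : exists a s, GRing.lreg s /\ psi s * q = psi a.
Proof.
elim/tqr_ind: q => x; exists x.1, x.2; split; first exact: fp_reg.
change (tqr_mul (psi x.2) (\pi_(total_quotient_ring S)%qT x) = psi x.1).
by rewrite pi_tqr_mul; apply/tqrP => /=; rewrite mulr1 mul1r mulrC.
Qed.

Lemma tqr_unit s : GRing.lreg s -> exists q : Q, q * psi s = 1.
Proof.
move=> sreg; exists (\pi_(total_quotient_ring S)%qT (mk_fp 1 sreg)).
change (tqr_mul (\pi_(total_quotient_ring S)%qT (mk_fp 1 sreg)) (psi s) = psi 1).
by rewrite pi_tqr_mul; apply/tqrP => /=; rewrite !mulr1 mul1r.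
Qed.

Lemma tqr_lreg s : GRing.lreg s -> GRing.lreg (psi s).
Proof.
move=> /tqr_unit[q qs] x y h.
by rewrite -[x]mul1r -[y]mul1r -qs -!mulrA h.
Qed.

Lemma tqr_common_denominator (L : seq Q) :
  exists s, GRing.lreg s /\ forall q, q \in L -> exists a, psi s * q = psi a.
Proof.
elim: L => [|q L [s [sreg hs]]]; first by exists 1; split=> //; exact: lreg1.
have [a [t [treg tq]]] := tqr_fraction q.
exists (s * t); split=> [|q']; first exact: lregM.
rewrite inE => /orP[/eqP ->|/hs[b qb]].
  by exists (s * a); rewrite !rmorphM -mulrA tq.
by exists (t * b); rewrite !rmorphM mulrAC qb mulrC.
Qed.

Section Module.
Variable N : lmodType S.

(** Clear the denominators in the expression of n as a combination of relations
    ([tensor_eq_relations]): what is left is an identity over S. *)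
Lemma tqr_tensor_eq0 (n : N) : tensor psi n 1 = 0 ->
  exists s, GRing.lreg s /\ s *: n = 0.
Proof.
move=> n0; have /tensor_eq_relations[L [L0 Lg]] : tensor_eq psi [:: (n, 1)] [::].
  by apply/base_changeP; rewrite !pi_formal_sum big_seq1 big_nil.
have [s [sreg hs]] := tqr_common_denominator [seq cz.1 | cz <- L].
have /choice[b hb] : forall c, exists b, c \in [seq cz.1 | cz <- L] ->
    psi s * c = psi b.
  move=> c; have [cL|_] := boolP (c \in [seq cz.1 | cz <- L]).
    by have [b] := hs c cL; exists b.
  by exists 0.
exists s; split=> //.
pose z := flatten [seq [seq (p.1, - b cz.1 * p.2) | p <- cz.2] | cz <- L].
have zE (V : zmodType) (F : N * S -> V) : \sum_(p <- z) F p =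
    \sum_(cz <- L) \sum_(p <- cz.2) F (p.1, - b cz.1 * p.2).
  by rewrite big_flatten big_map; apply: eq_bigr => i _; rewrite big_map.
have : \sum_(p <- (n, s) :: z) p.2 *: p.1 = 0.
  apply: formal_zero => l; apply: to_tqr_inj; rewrite rmorph0.
  have := congr1 (fun q => psi s * q) (Lg (fun y => psi (y == l)%:R)).
  rewrite big_seq1 big_nil subr0 mul1r big_cons zE rmorphD rmorphM /= => ->.
  rewrite rmorph_sum mulr_sumr big_seq_cond [X in _ + X]big_seq_cond -big_split.
  rewrite big1 // => cz; rewrite andbT => czL /=.
  rewrite mulrA hb ?map_f // rmorph_sum mulr_sumr -big_split big1 // => p _ /=.
  by rewrite -!rmorphM -rmorphD !mulNr mulrA subrr rmorph0.
rewrite big_cons zE /= [X in _ + X]big_seq_cond [X in _ + X]big1 ?addr0 // => cz.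
rewrite andbT => czL.
under eq_bigr do rewrite -scalerA.
by rewrite -scaler_sumr L0 // scaler0.
Qed.

Lemma tqr_tensor_fraction (w : base_change psi N) :
  exists s n, GRing.lreg s /\ psi s *: w = tensor psi n 1.
Proof.
have [k [x [q ->]]] := base_change_sum w.
have [s [sreg hs]] := tqr_common_denominator [seq q i | i <- iota 0 k].
have /choice[b hb] : forall i, exists b, (i < k)%N -> psi s * q i = psi b.
  move=> i; have [ik|_] := boolP (i < k)%N; last by exists 0.
  have [|b] := hs (q i); last by exists b.
  by apply: map_f; rewrite mem_iota.
exists s, (\sum_(i < k) b i *: x i); split=> //.
rewrite (semilinear_sum (@tensor_semilinear _ _ psi N)) scaler_sumr.
apply: eq_bigr => i _.
by rewrite (semilinearZ (@tensor_semilinear _ _ psi N)) scalerA hb.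
Qed.

End Module.
End TotalQuotient.

(** * Ideals of a one-dimensional local domain *)

Section NoetherianIdeals.
Variable R : comPzRingType.
Implicit Types I J P : set R.

Lemma ideal_sum I k (F : 'I_k -> R) : ideal I -> (forall i, I (F i)) ->
  I (\sum_(i < k) F i).
Proof.
by move=> [I0 ID _] IF; elim/big_rec: _ => // i x _; apply: ID.
Qed.

Lemma ideal_opp I x : ideal I -> I x -> I (- x).
Proof. by move=> [_ _ IM]; rewrite -mulN1r; apply: IM. Qed.

Lemma ideal_span_min (A : set R) I : ideal I -> A `<=` I -> ideal_span A `<=` I.
Proof.
move=> idI AI x [k [c [v [Av ->]]]]; apply: ideal_sum => // i.
by case: idI => _ _; apply; apply: AI.
Qed.

Lemma sub_ideal_span (A : set R) : A `<=` ideal_span A.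
Proof.
move=> x Ax; exists 1%N, (fun=> 1), (fun=> x); split=> //.
by rewrite big_ord1 scale1r.
Qed.

Definition ideal_adjoin I (x : R) : set R :=
  [set z | exists y a, I y /\ z = y + a * x].

Lemma ideal_adjoinP I x : ideal I ->
  [/\ ideal (ideal_adjoin I x), I `<=` ideal_adjoin I x & ideal_adjoin I x x].
Proof.
move=> [I0 ID IM]; split; last by exists 0, 1; rewrite add0r mul1r.
  split; first by exists 0, 0; rewrite mul0r addr0.
    move=> _ _ [y [a [Iy ->]]] [z [b [Iz ->]]]; exists (y + z), (a + b).
    by split; [exact: ID | rewrite mulrDl addrACA].
  move=> b _ [y [a [Iy ->]]]; exists (b * y), (b * a); split; first exact: IM.
  by rewrite mulrDr mulrA.
by move=> y Iy; exists y, 0; rewrite mul0r addr0.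
Qed.

Hypothesis noethR : noetherian R.

Lemma noetherian_max (P : set (set R)) : (forall I, P I -> ideal I) ->
  (exists I, P I) -> exists2 I, P I & forall J, P J -> I `<=` J -> J = I.
Proof.
move=> idP [I0 PI0]; apply: contrapT => nomax.
have /choice[nxt hnxt] : forall I, exists J, P I -> [/\ P J, I `<=` J & J <> I].
  move=> I; have [PI|nPI] := pselect (P I); last by exists I.
  apply: contrapT => noJ; apply: nomax; exists I => // J PJ IJ.
  by apply: contrapT => JI; apply: noJ; exists J.
pose C k := iter k nxt I0.
have PC k : P (C k) by elim: k => // k /hnxt[].
have CS k : C k `<=` C k.+1 by case: (hnxt _ (PC k)).
have Cle j k : (j <= k)%N -> C j `<=` C k.
  elim: k => [|k IH]; first by rewrite leqn0 => /eqP ->.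
  rewrite leq_eqVlt => /orP[/eqP -> //|]; rewrite ltnS => /IH h x /h; exact: CS.
pose U : set R := [set x | exists k, C k x].
have idU : ideal U.
  split.
  - by exists 0%N; case: (idP _ (PC 0%N)).
  - move=> x y [j Cx] [k Cy]; exists (maxn j k).
    case: (idP _ (PC (maxn j k))) => _ + _; apply.
      exact: Cle (leq_maxl _ _) _ Cx.
    exact: Cle (leq_maxr _ _) _ Cy.
  - by move=> a x [k Cx]; exists k; case: (idP _ (PC k)) => _ _; apply.
have [A [finA UA]] := noethR idU.
have [s As] : exists s : seq R, A = [set` s] by apply/finite_seqP.
have [k hk] : exists k, forall x, x \in s -> C k x.
  have : forall x, x \in s -> U x.
    by move=> x xs; rewrite UA; apply: sub_ideal_span; rewrite As.
  elim: (s) => [|y t IH] hU; first by exists 0%N.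
  have [k hk] := IH (fun x xt => hU x (mem_behead (s := y :: t) xt)).
  have [j Cy] := hU y (mem_head _ _); exists (maxn j k) => x.
  rewrite inE => /orP[/eqP ->|/hk]; first exact: Cle (leq_maxl _ _) _ Cy.
  exact: Cle (leq_maxr _ _) _.
have UC : U `<=` C k.
  by rewrite UA; apply: ideal_span_min; [exact: idP | rewrite As => x /hk].
case: (hnxt _ (PC k)) => _ _; apply; apply/seteqP; split=> // x Cx.
by apply: UC; exists k.+1.
Qed.

Lemma noetherian_maximal_ideal I : ideal I -> ~ I 1 ->
  exists2 m, maximal_ideal m & I `<=` m.
Proof.
move=> idI I1.
have [|m [idm m1 Im] mmax] := @noetherian_max
    (fun J => [/\ ideal J, ~ J 1 & I `<=` J]) (fun J h => let: And3 idJ _ _ := h in idJ).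
  by exists I; split.
exists m => //; split=> // J idJ J1 mJ; apply: mmax => //; split=> //.
exact: subset_trans mJ.
Qed.

Lemma maximal_ideal_prime (m : set R) : maximal_ideal m -> prime_ideal m.
Proof.
move=> [idm m1 mmax]; split=> // x y mxy.
have [mx|mx] := pselect (m x); [by left | right].
have [idJ mJ Jx] := ideal_adjoinP x idm.
have [[u [a [mu uE]]]|J1] := pselect (ideal_adjoin m x 1); last first.
  by case: mx; rewrite -(mmax _ idJ J1 mJ).
have -> : y = y * u + a * (x * y) by rewrite mulrA [y * u]mulrC -mulrDl -uE mul1r.
by case: idm => _ mD mM; apply: mD; apply: mM.
Qed.

End NoetherianIdeals.

Section LocalDomain.
Variables (R : idomainType) (m : set R).
Hypotheses (localR : local_ring_with m) (noethR : noetherian R).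

Lemma local_unit (a : R) : ~ m a -> a \is a GRing.unit.
Proof.
move=> nma.
have idZ : ideal [set (0 : R)].
  by split=> [//|x y -> ->|b x ->]; rewrite ?addr0 ?mulr0.
have [idJ _ Ja] := ideal_adjoinP a idZ.
have [[_ [b [-> h]]]|J1] := pselect (ideal_adjoin [set 0] a 1).
  by apply/unitrPr; exists b; rewrite mulrC h add0r.
have [m' /(proj2 localR) -> Jm] := noetherian_maximal_ideal noethR idJ J1.
by case: nma; apply: Jm.
Qed.

Hypothesis dim1 : krull_dim R 1.

(** Otherwise 0 < P < m would be a chain of length two. *)
Lemma dim1_prime P (d : R) : prime_ideal P -> P d -> d != 0 -> P = m.
Proof.
move=> Pp Pd d0; have [idP P1 _] := Pp.
have [m' /(proj2 localR) -> Pm] := noetherian_maximal_ideal noethR idP P1.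
apply: contrapT => PNm.
pose Q (i : nat) : set R := if i is i'.+1 then (if i' is 0 then P else m) else [set 0].
suff : (2 <= 1)%N by [].
apply: (proj2 dim1 2%N Q); split=> [[|[|i]] _|[|[|i]] //= _].
- split=> [|/eqP|x y /eqP]; first by split=> [//|x y -> ->|b x ->]; rewrite ?addr0 ?mulr0.
    by rewrite oner_eq0.
  by rewrite mulf_eq0 => /orP[]/eqP; [left | right].
- exact: Pp.
- exact: maximal_ideal_prime (proj1 localR).
- split=> [x ->|h]; first by case: idP.
  by move/h/eqP: Pd; rewrite (negPf d0).
- by split=> // mP; apply: PNm; apply/seteqP.
Qed.

Lemma dim1_nonzero_nonunit : exists2 r, m r & r != 0.
Proof.
have [[P [Pp PS]] _] := dim1.
have [P01 nP01] := PS 0%N isT.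
have [idP1 P11 _] := Pp 1%N isT.
have [m' /(proj2 localR) -> Pm] := noetherian_maximal_ideal noethR idP1 P11.
apply: contrapT => h; apply: nP01 => x P1x.
have [->|x0] := eqVneq x 0; first by case: (Pp 0%N isT) => -[].
by case: h; exists x => //; apply: Pm.
Qed.

Definition contains_power (I : set R) c : Prop :=
  forall a : 'I_c -> R, (forall i, m (a i)) -> I (\prod_(i < c) a i).

(** An ideal maximal among those that contain d but no power of m is prime:
    if x and y are outside it, then the ideals obtained by adjoining x and y
    contain powers of m, and their product is inside it when x y is.  So it is
    m itself, which is absurd. *)
Lemma dim1_contains_power I d : ideal I -> I d -> d != 0 ->
  exists c, contains_power I c.
Proof.
move=> idI Id d0; apply: contrapT => nI.
have [_ [//]||P [idP Pd nP] Pmax] := @noetherian_max _ noethR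
  (fun J => [/\ ideal J, J d & ~ exists c, contains_power J c]).
  by exists I; split.
have PM x y : P x -> P (x * y) by case: idP => _ _ PM; rewrite mulrC; apply: PM.
have P1 : ~ P 1.
  by move=> P1; apply: nP; exists 0%N => a _; rewrite big_ord0.
have adj x : ~ P x -> exists c, contains_power (ideal_adjoin P x) c.
  move=> Px; have [idJ PJ Jx] := ideal_adjoinP x idP.
  apply: contrapT => nJ; apply: Px.
  by rewrite -(Pmax _ _ PJ) //; split=> //; apply: PJ.
have primeP : prime_ideal P.
  split=> // x y Pxy; apply: contrapT => /not_orP[/adj[b hb] /adj[c hc]].
  apply: nP; exists (b + c)%N => a ma; rewrite big_split_ord /=.
  have [u [e [Pu ->]]] := hb (fun i => a (lshift c i)) (fun i => ma _).
  have [v [f [Pv ->]]] := hc (fun i => a (rshift b i)) (fun i => ma _).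
  rewrite mulrDl; case: (idP) => _ PD _; apply: (PD); first exact: PM.
  rewrite mulrDr; apply: PD; first by rewrite mulrC; apply: PM.
  by rewrite mulrACA mulrC; apply: PM.
apply: nP; exists 1%N => a ma; rewrite big_ord1.
by rewrite (dim1_prime primeP Pd d0).
Qed.

End LocalDomain.

Lemma contains_power_ideal_pow (R : idomainType) (m I : set R) c x : ideal I ->
  contains_power m I c -> ideal_pow m c x -> I x.
Proof.
move=> idI hc; apply: ideal_span_min => // _ [a [ma ->]]; exact: hc.
Qed.

(** * The completion of a one-dimensional local domain *)

Definition divides (R : pzSemiRingType) (d x : R) : Prop := exists b, x = d * b.

Lemma ideal_span_seq (R : comPzRingType) (l : seq R) x :
  ideal_span [set` l] x -> exists c : nat -> R, x = \sum_(i < size l) c i * l`_i.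
Proof.
move: x; apply: ideal_span_min.
  split.
  - by exists (fun=> 0); rewrite big1 // => i _; rewrite mul0r.
  - move=> _ _ [c ->] [d ->]; exists (fun i => c i + d i); rewrite -big_split.
    by apply: eq_bigr => i _; rewrite mulrDl.
  - move=> a _ [c ->]; exists (fun i => a * c i); rewrite mulr_sumr.
    by apply: eq_bigr => i _; rewrite mulrA.
move=> x xl; exists (fun i => (i == index x l)%:R).
have xi : (index x l < size l)%N by rewrite index_mem.
rewrite (bigD1 (Ordinal xi)) //= eqxx mul1r nth_index // big1 ?addr0 // => i.
by rewrite -val_eqE /= => /negPf ->; rewrite mul0r.
Qed.

Section CompletionDim1.
Variables (R : idomainType) (m : set R).
Hypotheses (localR : local_ring_with m) (noethR : noetherian R).
Hypothesis dim1 : krull_dim R 1.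
Local Notation S := (completion m).
Local Notation phi := (to_completion m : {rmorphism R -> completion m}).
Local Notation cls := (\pi_(completion m))%qT.

Lemma divides_ideal (d : R) : ideal (divides d).
Proof.
split.
- by exists 0; rewrite mulr0.
- by move=> _ _ [b ->] [c ->]; exists (b + c); rewrite mulrDr.
- by move=> a _ [b ->]; exists (a * b); rewrite mulrCA.
Qed.

Lemma ideal_pow_divides (d : R) : d != 0 ->
  exists c, forall x, ideal_pow m c x -> divides d x.
Proof.
move=> d0; have dd : divides d d by exists 1; rewrite mulr1.
have [c hc] := dim1_contains_power localR noethR dim1 (divides_ideal d) dd d0.
by exists c => x; apply: contains_power_ideal_pow; [exact: divides_ideal | ].
Qed.

Lemma ideal_pow_expM (r : R) n b : m r -> ideal_pow m n (r ^+ n * b).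
Proof.
move=> mr; rewrite mulrC; apply: ideal_powM; apply: sub_ideal_span.
by exists (fun=> r); split=> //; rewrite prodr_const card_ord.
Qed.

(** The powers of m and the principal ideals of nonzero elements define the same
    topology, which reduces all questions on the completion to divisibility. *)
Lemma adic_nullP (u : nat -> R) : adic_null m u <->
  forall d : R, d != 0 -> exists k, forall i, (k <= i)%N -> divides d (u i).
Proof.
split=> [u0 d d0|hu n].
  have [c hc] := ideal_pow_divides d0.
  by have [k hk] := u0 c; exists k => i /hk/hc.
have [r mr r0] := dim1_nonzero_nonunit localR noethR dim1.
have [k hk] := hu (r ^+ n) (expf_neq0 _ r0).
by exists k => i /hk[b ->]; apply: ideal_pow_expM.
Qed.

Lemma adic_cauchyP (u : nat -> R) : adic_cauchy m u <->
  forall d : R, d != 0 -> exists k, forall i j, (k <= i)%N -> (k <= j)%N ->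
    divides d (u i - u j).
Proof.
split=> [u0 d d0|hu n].
  have [c hc] := ideal_pow_divides d0.
  by have [k hk] := u0 c; exists k => i j ki kj; apply/hc/hk.
have [r mr r0] := dim1_nonzero_nonunit localR noethR dim1.
have [k hk] := hu (r ^+ n) (expf_neq0 _ r0).
by exists k => i j ki kj; have [b ->] := hk i j ki kj; apply: ideal_pow_expM.
Qed.

Lemma mk_cauchy (u : nat -> R) :
  (forall d : R, d != 0 -> exists k, forall i j, (k <= i)%N -> (k <= j)%N ->
    divides d (u i - u j)) -> exists v : cauchy_seq m, cauchy_val v = u.
Proof.
by move=> /adic_cauchyP hu; exists (CauchySeq (introT (asboolP _) hu)).
Qed.

Lemma cauchy_seqP (u : cauchy_seq m) d : d != 0 ->
  exists k, forall i j, (k <= i)%N -> (k <= j)%N -> divides d (u i - u j).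
Proof. by case: u => u /= /asboolP/adic_cauchyP; apply. Qed.

Lemma completion_linP (u : cauchy_seq m) a d (v : cauchy_seq m) :
  cls u = phi a + phi d * cls v <->
  forall e : R, e != 0 ->
    exists k, forall i, (k <= i)%N -> divides e (u i - (a + d * v i)).
Proof.
have -> : phi a + phi d * cls v =
    cls (CauchySeq (cst_cauchy m a) + CauchySeq (cst_cauchy m d) * v).
  by rewrite -pi_cpl_add -pi_cpl_mul.
rewrite completionP adic_nullP; split=> h e /h[k hk]; exists k => i /hk;
  by rewrite cauchy_valD cauchy_valM.
Qed.

(** The quotients by d of the terms u i - a form a Cauchy sequence again. *)
Lemma completion_near (u : cauchy_seq m) a d k : d != 0 ->
  (forall i, (k <= i)%N -> divides d (u i - a)) ->
  exists t, cls u = phi a + phi d * t.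
Proof.
move=> d0 hu.
have /choice[v hv] : forall i, exists vi, (k <= i)%N -> u i - a = d * vi.
  move=> i; have [/hu[b ->]|_] := boolP (k <= i)%N; first by exists b.
  by exists 0.
have [|v' v'E] := @mk_cauchy v.
  move=> e e0; have [l hl] := cauchy_seqP u (mulf_neq0 d0 e0).
  exists (maxn k l) => i j; rewrite !geq_max => /andP[ki li] /andP[kj lj].
  have [b hb] := hl i j li lj; exists b; apply: (mulfI d0).
  rewrite mulrA -hb mulrBr -!hv //.
  by rewrite opprB addrA subrK.
exists (cls v'); apply/completion_linP => e e0; exists k => i ki.
by rewrite v'E -hv // [a + _]addrC subrK subrr; exists 0; rewrite mulr0.
Qed.

Lemma completion_split (d : R) (s : S) : d != 0 ->
  exists a t, s = phi a + phi d * t.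
Proof.
move=> d0; elim/completion_ind: s => u.
have [k hk] := cauchy_seqP u d0.
by exists (u k); apply: (@completion_near _ _ _ k) => // i ki; apply: hk.
Qed.

Lemma completion_cap (d a : R) (t : S) : d != 0 -> phi a = phi d * t ->
  divides d a.
Proof.
move=> d0; elim/completion_ind: t => v; rewrite -[RHS]add0r -(rmorph0 phi).
move=> /completion_linP/(_ d d0)[k /(_ k (leqnn k))[b /= hb]].
exists (b + v k); rewrite mulrDr -hb add0r.
by rewrite subrK.
Qed.

Lemma completion_reg (d : R) : d != 0 -> GRing.lreg (phi d).
Proof.
move=> d0 x y /eqP; rewrite -subr_eq0 -mulrBr => /eqP h; apply/eqP.
rewrite -subr_eq0; apply/eqP; move: (x - y) h => {x y} x.
elim/completion_ind: x => v h.
have : phi 0 = phi 0 + phi d * cls v by rewrite h rmorph0 addr0.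
move=> /completion_linP hv.
have -> : (0 : S) = cls (CauchySeq (cst_cauchy m 0)) by rewrite -(rmorph0 phi).
apply/completionP/adic_nullP => e e0.
have [k hk] := hv (d * e) (mulf_neq0 d0 e0); exists k => i /hk[b /= hb].
rewrite -[X in divides e X]/(v i - 0) subr0.
exists (- b); apply: (mulfI d0); rewrite mulrA mulrN -hb.
by rewrite !add0r opprK.
Qed.

Lemma completion_separated (r : R) (x : S) : m r -> r != 0 ->
  (forall n, divides (phi r ^+ n) x) -> x = 0.
Proof.
move=> mr r0; elim/completion_ind: x => u hu.
have -> : (0 : S) = cls (CauchySeq (cst_cauchy m 0)) by rewrite -(rmorph0 phi).
apply/completionP/adic_nullP => e e0.
have [c hc] := ideal_pow_divides e0.
have [t ut] := hu c.
have {ut} : cls u = phi 0 + phi (r ^+ c) * t by rewrite rmorph0 add0r rmorphXn.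
elim/completion_ind: t => v /completion_linP/(_ e e0)[k hk]; exists k => i /hk[b hb].
have [b' hb'] := hc _ (ideal_pow_expM c (v i) mr).
rewrite -[X in divides e X]/(u i - 0) subr0.
by exists (b + b'); rewrite mulrDr -hb -hb' add0r subrK.
Qed.

(** The partial sums are congruent modulo r^n to elements b n of R, by density,
    and the b n form a Cauchy sequence. *)
Lemma completion_power_series (r : R) (c : nat -> S) : m r -> r != 0 ->
  exists x : S, forall n,
    divides (phi r ^+ n) (x - \sum_(i < n) phi r ^+ i * c i).
Proof.
move=> mr r0; pose P n := \sum_(i < n) phi r ^+ i * c i.
have /choice[bt hb] : forall n, exists bt : R * S, P n = phi bt.1 + phi r ^+ n * bt.2.
  move=> n; have [b [t h]] := completion_split (P n) (expf_neq0 n r0).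
  by exists (b, t); rewrite h rmorphXn.
pose b n := (bt n).1.
have bS n : divides (r ^+ n) (b n.+1 - b n).
  apply: (@completion_cap _ _ (c n - phi r * (bt n.+1).2 + (bt n).2)).
    exact: expf_neq0.
  have hS : P n.+1 = P n + phi r ^+ n * c n by rewrite /P big_ord_recr.
  rewrite rmorphB rmorphXn mulrDr mulrBr mulrA -exprSr /b.
  have -> : phi (bt n.+1).1 = P n.+1 - phi r ^+ n.+1 * (bt n.+1).2 by rewrite hb addrK.
  have -> : phi (bt n).1 = P n - phi r ^+ n * (bt n).2 by rewrite hb addrK.
  rewrite hS opprB addrA addrAC -(addrA (P n)) [P n + (_ - _)]addrC addrK.
  by [].
have bD n k : divides (r ^+ n) (b (n + k)%N - b n).
  elim: k => [|k [e IH]]; first by rewrite addn0 subrr; exists 0; rewrite mulr0.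
  have [f hf] := bS (n + k)%N.
  exists (r ^+ k * f + e); rewrite mulrDr -IH mulrA -exprD -hf addnS.
  by rewrite addrA subrK.
have [|x xE] := @mk_cauchy b.
  move=> d d0; have [k hk] := ideal_pow_divides d0; exists k => i j ki kj.
  have [e he] := bD k (i - k)%N; have [f hf] := bD k (j - k)%N.
  rewrite subnKC // in he; rewrite subnKC // in hf.
  have -> : b i - b j = r ^+ k * (e - f).
    by rewrite mulrBr -he -hf opprB addrA subrK.
  by apply: hk; apply: ideal_pow_expM.
exists (cls x) => n.
have [|t ht] := @completion_near x (b n) _ n (expf_neq0 n r0).
  by move=> i ni; rewrite xE -(subnKC ni); apply: bD.
exists (t - (bt n).2); rewrite ht -/(P n) hb rmorphXn mulrBr opprD.
by rewrite addrACA subrr add0r.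
Qed.

Lemma completion_dense : dense_extension phi.
Proof.
split.
- exact: completion_reg.
- by move=> d s; apply: completion_split.
- exact: completion_cap.
move=> n b u one.
have [r mr r0] := dim1_nonzero_nonunit localR noethR dim1.
apply: contrapT => h.
have mb i : (i < n)%N -> m (b i).
  move=> ilt; apply: contrapT => /(local_unit localR noethR) bu.
  by apply: h; exists i.
have /choice[at' hat] : forall i, exists at' : R * S, u i = phi at'.1 + phi r * at'.2.
  by move=> i; have [a [t ->]] := completion_split (u i) r0; exists (a, t).
have [[idm m1 _] _] := localR; apply: m1.
have [_ mD mM] := idm.
have [e he] : divides r (1 - \sum_(i < n) (at' i).1 * b i).
  apply: (@completion_cap _ _ (\sum_(i < n) (at' i).2 * phi (b i))) => //.
  rewrite rmorphB rmorph1 one rmorph_sum -sumrB mulr_sumr; apply: eq_bigr => i _.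
  by rewrite hat rmorphM mulrDl addrC addKr mulrA.
rewrite -[1](subrK (\sum_(i < n) (at' i).1 * b i)) he mulrC; apply: (mD).
  exact: mM.
by apply: ideal_sum => // i; apply/mM/mb.
Qed.

(** The ring R/dR is Artinian.  By Noetherian induction, let I be maximal among
    the ideals, containing d, for which the statement fails; as I contains a
    power of m, there is y outside I with m y inside I.  A chain of ideals above
    I either keeps y, and then lies above I + R y, or loses y from some point
    on, and then meets I + R y in I. *)
Lemma dim1_descending_chain (C : nat -> set R) (d : R) : d != 0 ->
  (forall n, ideal (C n)) -> (forall n, C n.+1 `<=` C n) -> (forall n, C n d) ->
  exists n, C n `<=` C n.+1.
Proof.
move=> d0 idC dC Cd.
pose good I := forall C : nat -> set R, (forall n, ideal (C n)) ->
  (forall n, C n.+1 `<=` C n) -> (forall n, I `<=` C n) ->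
  exists n, C n `<=` C n.+1.
suff : good (divides d).
  apply=> // n x [b ->]; rewrite mulrC; by case: (idC n) => _ _; apply.
apply: contrapT => ngood.
have [_ [//]||I [idI Id nI] Imax] := @noetherian_max _ noethR
  (fun J => [/\ ideal J, J d & ~ good J]).
  exists (divides d); split=> //; first exact: divides_ideal.
  by exists 1; rewrite mulr1.
have adj y : ~ I y -> good (ideal_adjoin I y).
  move=> Iy; have [idJ IJ Jy] := ideal_adjoinP y idI.
  apply: contrapT => nJ; apply: Iy.
  by rewrite -(Imax _ _ IJ) //; split=> //; apply: IJ.
have I1 : ~ I 1.
  move=> I1; apply: nI => D idD _ ID; exists 0%N => x _.
  have := ID 1%N _ I1; case: (idD 1%N) => _ _ /(_ x 1); rewrite mulr1; exact.
(* the class of y spans a simple submodule of R/I *)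
have [y Iy my] : exists2 y, ~ I y & forall a, m a -> I (a * y).
  have [c hc] := dim1_contains_power localR noethR dim1 idI Id d0.
  elim: c hc => [|c IH] hc.
    by case: I1; have := hc (fun=> 0); rewrite big_ord0; apply; case.
  have [hc'|nc] := pselect (contains_power m I c); first exact: IH.
  have [a [ma Ia]] : exists a : 'I_c -> R, (forall i, m (a i)) /\ ~ I (\prod_(i < c) a i).
    apply: contrapT => h; apply: nc => a ma; apply: contrapT => Ia.
    by apply: h; exists a.
  exists (\prod_(i < c) a i) => // b mb.
  have := hc (fun i => if unlift ord0 i is Some j then a j else b).
  rewrite big_ord_recl unlift_none; under eq_bigr do rewrite liftK.
  by apply=> i; case: unliftP.
apply: nI => D idD dD ID.
have Dle j k : (j <= k)%N -> D k `<=` D j.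
  elim: k => [|k IH]; first by rewrite leqn0 => /eqP ->.
  rewrite leq_eqVlt => /orP[/eqP -> //|]; rewrite ltnS => /IH h x /dD; exact: h.
have [yD|/existsNP[N nDy]] := pselect (forall n, D n y).
  apply: (adj y Iy) => // n z [u [a [Iu ->]]].
  case: (idD n) => _ DD DM; apply: DD; first exact: ID.
  exact: DM.
pose E n := ideal_adjoin (D (N + n)%N) y.
have [||n x [u [a [Iu ->]]]|n hn] := adj y Iy E.
- by move=> n; case: (ideal_adjoinP y (idD (N + n)%N)).
- move=> n _ [u [a [Du ->]]]; exists u, a; split=> //.
  by move: Du; rewrite addnS; apply: dD.
- by exists u, a; split=> //; apply: ID.
exists (N + n)%N => x Dx.
have [u [a [Du xE]]] : E n.+1 x by apply: hn; exists x, 0; rewrite mul0r addr0.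
rewrite addnS in Du.
have Day : D (N + n)%N (a * y).
  have -> : a * y = x + - u by rewrite xE addrC addKr.
  case: (idD (N + n)%N) => _ DD _; apply: DD => //.
  by apply: ideal_opp => //; apply: dD.
have Iay : I (a * y).
  apply: my; apply: contrapT => /(local_unit localR noethR) ua.
  apply: nDy; apply: (Dle N (N + n)%N (leq_addr _ _)).
  rewrite -[y](mulKr ua).
  by case: (idD (N + n)%N) => _ _; apply.
rewrite xE; case: (idD (N + n).+1) => _ DD _; apply: DD => //.
exact: ID.
Qed.

(** Let J n be the set of the x with r^k x in s^n S for some k.  Modulo r these
    ideals stabilize, say J n = J n.+1 + rS on J n; as J n is saturated with
    respect to r, in fact J n = J n.+1 + r (J n).  Iterating with finitely many
    generators g of J n.+1 modulo r, and summing the resulting power series in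
    r, gives J n = J n.+1.  So s^n is in J n.+1, that is r^k s^n = s^(n+1) t,
    and s^n can be cancelled. *)
Lemma completion_reg_divides (r : R) (s : S) : m r -> r != 0 -> GRing.lreg s ->
  exists k, divides s (phi r ^+ k).
Proof.
move=> mr r0 sreg.
pose J n : set S := [set x | exists k, divides (s ^+ n) (phi r ^+ k * x)].
have idJ n : ideal (J n).
  split.
  - by exists 0%N, 0; rewrite !mulr0.
  - move=> x y [k [b hb]] [l [c hc]]; exists (k + l)%N.
    exists (phi r ^+ l * b + phi r ^+ k * c).
    rewrite [LHS]mulrDr [RHS]mulrDr !(mulrCA (s ^+ n)) -hb -hc !mulrA -!exprD.
    by rewrite [(l + k)%N]addnC.
  - move=> a x [k [b hb]]; exists k, (a * b).
    by rewrite mulrCA hb mulrCA.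
have Jsub n : J n.+1 `<=` J n.
  by move=> x [k [b hb]]; exists k, (s * b); rewrite hb exprSr mulrA.
have Jsat n x : J n (phi r * x) -> J n x.
  by move=> [k hk]; exists k.+1; rewrite exprSr -mulrA.
pose I n : set R := [set a | exists t, J n (phi a + phi r * t)].
have idI n : ideal (I n).
  have [J0 JD JM] := idJ n; split.
  - by exists 0; rewrite rmorph0 mulr0 addr0.
  - move=> a b [t ht] [u hu]; exists (t + u).
    by rewrite rmorphD mulrDr addrACA; apply: JD.
  - move=> b a [t ht]; exists (phi b * t).
    by rewrite rmorphM mulrCA -mulrDr; apply: JM.
have [n hn] : exists n, I n `<=` I n.+1.
  apply: (@dim1_descending_chain _ r) => // n.
    by move=> a [t /Jsub ht]; exists t.
  by exists (- 1); rewrite mulrN1 subrr; case: (idJ n).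
have [A [finA IA]] := noethR (idI n.+1).
have [l As] : exists l : seq R, A = [set` l] by apply/finite_seqP.
have /choice[t ht] : forall a, exists t, a \in l -> J n.+1 (phi a + phi r * t).
  move=> a; have [al|_] := boolP (a \in l); last by exists 0.
  have [t ht] : I n.+1 a by rewrite IA; apply: sub_ideal_span; rewrite As.
  by exists t.
(* lifts to J n.+1 of generators of its image in R/rR *)
pose g a := phi a + phi r * t a.
have step x : J n x -> exists cx : (nat -> S) * S,
    J n cx.2 /\ x = \sum_(i < size l) cx.1 i * g l`_i + phi r * cx.2.
  move=> Jx; have [a [u xE]] := completion_split x r0.
  have /hn : I n a.
    exists u; rewrite -xE; exact: Jx.
  rewrite IA As => /ideal_span_seq[b aE].
  exists (fun i => phi (b i), u - \sum_(i < size l) phi (b i) * t l`_i).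
  have xE' : x = \sum_(i < size l) phi (b i) * g l`_i +
      phi r * (u - \sum_(i < size l) phi (b i) * t l`_i).
    rewrite mulrBr addrCA {1}xE addrC; congr (_ + _).
    rewrite mulr_sumr -sumrB aE rmorph_sum; apply: eq_bigr => i _.
    by rewrite /g rmorphM mulrDr mulrCA addrK.
  split=> //=; apply: Jsat.
  have [_ JD JM] := idJ n.
  rewrite -[phi r * _](addKr (\sum_(i < size l) phi (b i) * g l`_i)) -xE' addrC.
  apply: (JD) => //; apply: ideal_opp => //; apply: ideal_sum => // i.
  by apply: JM; apply/Jsub/ht/mem_nth.
have Jsn : J n (s ^+ n) by exists 0%N, 1; rewrite expr0 mul1r mulr1.
pose x0 : {x | J n x} := exist _ (s ^+ n) Jsn.
have /choice[next hnext] : forall x : {x | J n x}, exists cy : (nat -> S) * {x | J n x},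
    sval x = \sum_(i < size l) cy.1 i * g l`_i + phi r * sval cy.2.
  by move=> [x Jx]; have [[c y] [/= Jy xE]] := step x Jx; exists (c, exist _ y Jy).
(* X i is the remainder in J n after i steps of the division by g and r *)
pose X i := iter i (fun x => (next x).2) x0.
pose c i j := (next (X i)).1 j.
have Xsum k : sval x0 = \sum_(j < size l) (\sum_(i < k) phi r ^+ i * c i j) * g l`_j
    + phi r ^+ k * sval (X k).
  elim: k => [|k IH].
    by rewrite expr0 mul1r big1 ?add0r // => j _; rewrite big_ord0 mul0r.
  rewrite IH hnext mulrDr addrA mulrA -exprSr; congr (_ + _).
  rewrite mulr_sumr -big_split; apply: eq_bigr => j _ /=.
  by rewrite big_ord_recr /= mulrDl mulrA.
have /choice[C hC] : forall j, exists Cj, forall k,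
    divides (phi r ^+ k) (Cj - \sum_(i < k) phi r ^+ i * c i j).
  by move=> j; apply: (completion_power_series (fun i => c i j) mr r0).
have x0E : s ^+ n = \sum_(j < size l) C j * g l`_j.
  apply/eqP; rewrite -subr_eq0; apply/eqP.
  apply: (completion_separated mr r0) => k.
  have /choice[e he] : forall j, exists e,
      C j = \sum_(i < k) phi r ^+ i * c i j + phi r ^+ k * e.
    by move=> j; have [e he] := hC j k; exists e; rewrite -he addrC subrK.
  exists (sval (X k) - \sum_(j < size l) e j * g l`_j).
  rewrite -[s ^+ n]/(sval x0) (Xsum k) mulrBr addrAC [RHS]addrC; congr (_ + _).
  rewrite -sumrB mulr_sumr -sumrN; apply: eq_bigr => j _.
  by rewrite he mulrDl opprD addrA subrr add0r mulrA.
have : J n.+1 (s ^+ n).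
  rewrite x0E; apply: ideal_sum => // j; have [_ _ JM] := idJ n.+1; apply: JM.
  exact/ht/mem_nth.
move=> [k [b hb]]; exists k, b.
have sn : GRing.lreg (s ^+ n) by 
  elim: (n) => [|i IH]; rewrite ?expr0 ?exprS; [exact: lreg1 | exact: lregM].
by apply: sn; rewrite mulrC hb exprSr mulrA.
Qed.

End CompletionDim1.

(** * Submodules, direct sums and retracts *)

Section Submodule.
Variables (R : pzRingType) (V : lmodType R) (A : set V).
Definition is_submodule : Prop :=
  A 0 /\ forall a x y, A x -> A y -> A (a *: x + y).
Hypothesis subA : is_submodule.

(** The proof of closure is an argument so that the module structure on
    [submodule], which depends on it, can be inferred from the predicate. *)
Definition submod_pred of is_submodule : {pred V} := [pred x | `[< A x >]].

Lemma submod_pred_closed : submod_closed (submod_pred subA).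
Proof.
case: subA => A0 AD; split; first exact/asboolP.
by move=> a x y /asboolP Ax /asboolP Ay; apply/asboolP/AD.
Qed.

HB.instance Definition _ := GRing.isSubmodClosed.Build R V (submod_pred subA)
  submod_pred_closed.

Record submodule := Submodule {
  submod_val :> V; _ : submod_val \in submod_pred subA }.

HB.instance Definition _ := [isSub for submod_val].
HB.instance Definition _ := [Choice of submodule by <:].
HB.instance Definition _ := [SubChoice_isSubLmodule of submodule by <:].

Lemma submod_valP (x : submodule) : A (submod_val x).
Proof. by case: x => x /= /asboolP. Qed.

Definition submod_in (x : V) (Ax : A x) : submodule :=
  Submodule (introT (asboolP _) Ax).

Lemma submod_val_linear a (x y : submodule) :
  submod_val (a *: x + y) = a *: submod_val x + submod_val y.
Proof. exact: (linearP (val : submodule -> V)). Qed.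

End Submodule.

Lemma linear0P (R : pzRingType) (V W : lmodType R) (f : V -> W) : linear f -> f 0 = 0.
Proof. by move=> /bundle_linear[f' fE]; rewrite -fE linear0. Qed.

Section DirectSumTheory.
Variables (R : pzRingType) (L : Type) (V : lmodType R).
Implicit Types f g : dsum L V.

Lemma dsum_valP a f g i : (a *: f + g) i = a *: f i + g i.
Proof. by have /= -> := linearP (val : dsum L V -> (L -> V)) a f g. Qed.

Lemma dsum_val0 i : (0 : dsum L V) i = 0.
Proof. by have /= -> := raddf0 (val : dsum L V -> (L -> V)). Qed.

Lemma dsum_valD f g i : (f + g) i = f i + g i.
Proof. by rewrite -[f]scale1r dsum_valP !scale1r. Qed.

Lemma dsum_valZ a f i : (a *: f) i = a *: f i.
Proof. by rewrite -[a *: f]addr0 dsum_valP dsum_val0 addr0. Qed.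

Lemma dsum_val_sum I (r : seq I) P (F : I -> dsum L V) i :
  (\sum_(k <- r | P k) F k) i = \sum_(k <- r | P k) F k i.
Proof.
by apply: (big_morph (fun f : dsum L V => f i)) => [f g|]; [exact: dsum_valD|exact: dsum_val0].
Qed.

Lemma dsum_ext f g : (forall i, f i = g i) -> f = g.
Proof. by move=> fg; apply: val_inj; apply/funext. Qed.

(** The index type is viewed as a choice type so that supports can be
    enumerated by sequences. *)
Definition covers (s : seq {classic L}) f : Prop :=
  uniq s /\ forall i, f i <> 0 -> (i : {classic L}) \in s.

Lemma dsum_mk (h : L -> V) (s : seq {classic L}) :
  (forall i : {classic L}, i \notin s -> h i = 0) ->
  exists f : dsum L V, forall i, f i = h i.
Proof.
move=> hs; have hf : h \in @finsupp R L V.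
  apply/asboolP; apply: (@sub_finite_set {classic L} _ [set` s]); last exact: finite_seq.
  by move=> i /= hi; apply: contrapT => /negP /hs.
by exists (DSum hf).
Qed.

Lemma dsum_covers f : exists s, covers s f.
Proof.
case: f => f /= hf; have /asboolP ff := hf.
have [s hs] := (finite_seqP ([set i | f i <> 0] : set {classic L})).1 ff.
exists (undup s); split; first exact: undup_uniq.
move=> i fi; rewrite mem_undup.
by have : [set i : {classic L} | f i <> 0] i by []; rewrite hs.
Qed.

Lemma dsum_covers2 f g : exists s, covers s f /\ covers s g.
Proof.
have [s [us hs]] := dsum_covers f; have [t [ut ht]] := dsum_covers g.
exists (undup (s ++ t)); split; split=> [|i h]; rewrite ?undup_uniq //;
  rewrite mem_undup mem_cat.
  by rewrite hs.
by rewrite ht ?orbT.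
Qed.

Lemma dsum_covers_seq n (f : nat -> dsum L V) :
  exists s, forall i, (i < n)%N -> covers s (f i).
Proof.
elim: n => [|n [s hs]]; first by exists [::].
have [t [ut ht]] := dsum_covers (f n).
exists (undup (s ++ t)) => i; rewrite ltnS leq_eqVlt => /orP[/eqP ->|/hs[us h]];
  split=> [|l fl]; rewrite ?undup_uniq // mem_undup mem_cat.
  by rewrite ht ?orbT.
by rewrite h.
Qed.

Definition delta (i : L) (v : V) (j : L) : V :=
  if (j : {classic L}) == i then v else 0.

Lemma delta_finsupp i v : delta i v \in @finsupp R L V.
Proof.
apply/asboolP; apply: (@sub_finite_set {classic L} _ [set` [:: (i : {classic L})]]).
  move=> j /=; rewrite /delta; case: eqP => [->|] // _.
  by rewrite inE.
exact: finite_seq.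
Qed.

Definition dsum_in i v : dsum L V := DSum (delta_finsupp i v).

Lemma dsum_inE i v (j : L) : dsum_in i v j = if (j : {classic L}) == i then v else 0.
Proof. by []. Qed.

Lemma dsum_in_linear i : linear (dsum_in i).
Proof.
move=> a x y; apply: dsum_ext => j; rewrite dsum_valP !dsum_inE.
by case: ifP; rewrite ?scaler0 ?addr0.
Qed.

Lemma dsum_sum_in s f : covers s f -> f = \sum_(i <- s) dsum_in i (f i).
Proof.
move=> [us hs]; apply: dsum_ext => j; rewrite dsum_val_sum.
have [js|js] := boolP ((j : {classic L}) \in s).
  rewrite (bigD1_seq (j : {classic L})) // dsum_inE eqxx big1 /= ?addr0 // => i ij.
  by rewrite /delta eq_sym (negPf ij).
rewrite big1_seq.
  by apply: contrapT => /hs; rewrite (negPf js).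
move=> i /= iS; rewrite /delta; case: eqP => // ji.
by rewrite ji iS in js.
Qed.

Variables (W : lmodType R) (h : L -> V -> W).
Hypothesis lin_h : forall i, linear (h i).

Definition dsum_out f : W := \sum_(i \in [set: {classic L}]) h i (f i).

Let h0 i : h i 0 = 0.
Proof. exact: linear0P. Qed.

Lemma dsum_outE s f : covers s f -> dsum_out f = \sum_(i <- s) h i (f i).
Proof.
move=> [us hs]; rewrite /dsum_out (fsbigE s) //.
  by apply: eq_bigl => i; apply: mem_set.
move=> i _ /negP is_; have [->|/eqP fi] := eqVneq (f i) 0; first exact: h0.
by case: is_; apply: hs.
Qed.

Lemma dsum_out_linear : linear dsum_out.
Proof.
move=> a f g; have [s [[us hf] [_ hg]]] := dsum_covers2 f g.
rewrite !(@dsum_outE s) //.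
  rewrite scaler_sumr -big_split; apply: eq_bigr => i _.
  by rewrite dsum_valP lin_h.
split=> // i; rewrite dsum_valP => fg; apply: contrapT => /negP is_; apply: fg.
have -> : f i = 0 by apply: contrapT => /hf; rewrite (negPf is_).
have -> : g i = 0 by apply: contrapT => /hg; rewrite (negPf is_).
by rewrite scaler0 addr0.
Qed.

End DirectSumTheory.

(** The complement of X is the kernel of the retraction. *)
Lemma in_Add_retract (R : pzRingType) (M X : lmodType R) (L : Type)
  (sigma : X -> dsum L M) (rho : dsum L M -> X) : linear sigma -> linear rho ->
  (forall x, rho (sigma x) = x) -> in_Add M X.
Proof.
move=> lin_s lin_r rs.
have subK : is_submodule [set z | rho z = 0].
  split=> [|a x y /= hx hy]; first exact: linear0P.
  by rewrite lin_r hx hy scaler0 addr0.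
exists L, (submodule subK).
pose F (p : (X * submodule subK)%type) : dsum L M := sigma p.1 + submod_val p.2.
have linF : linear F.
  move=> a p q; rewrite /F (lin_s a p.1 q.1 : sigma (a *: p + q).1 = _).
  rewrite (submod_val_linear a p.2 q.2 : submod_val (a *: p + q).2 = _).
  by rewrite scalerDr addrACA.
have [F' FE] := bundle_linear linF.
have rho0 z : rho (z - sigma (rho z)) = 0.
  by rewrite addrC -scaleN1r lin_r rs scaleN1r addNr.
exists F', (fun z => (rho z, submod_in subK (rho0 z))).
  move=> [x [y hy]]; rewrite FE /F /=.
  have ry : rho y = 0 by have /asboolP := hy.
  have xE : rho (sigma x + y) = x by rewrite -[sigma x]scale1r lin_r rs ry addr0 scale1r.
  congr (_, _); first exact: xE.
  by apply: val_inj; rewrite /= xE addrC addKr.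
by move=> z; rewrite FE /F /= addrC subrK.
Qed.

Lemma in_Add_section (R : pzRingType) (M N : lmodType R) : in_Add M N ->
  exists (L : Type) (sigma : {linear N -> dsum L M}) (rho : {linear dsum L M -> N}),
    forall x, rho (sigma x) = x.
Proof.
move=> [L [Y [F [G FG GF]]]]; exists L.
have linG : linear G by move=> a x y; apply: (can_inj FG); rewrite linearP !GF.
have [|sigma sE] := @bundle_linear _ _ _ (fun x : N => F (x, 0 : Y)).
  move=> a x y; rewrite -linearP; congr (F (_, _)).
  by rewrite [RHS]addr0; exact: (esym (scaler0 _ _)).
have [|rho rE] := @bundle_linear _ _ _ (fun z => (G z).1).
  by move=> a x y; rewrite linG.
by exists sigma, rho => x; rewrite rE sE FG.
Qed.

(** Finitely many elements of N have their images in finitely many of the copies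
    of M. *)
Lemma in_Add_factor (R : pzRingType) (M N : lmodType R) : in_Add M N ->
  forall q (n : nat -> N), exists k (f : nat -> {linear M -> N}) (g : nat -> {linear N -> M}),
    forall i, (i < q)%N -> \sum_(j < k) f j (g j (n i)) = n i.
Proof.
move=> /in_Add_section[L [sigma [rho rs]]] q n.
have [s hs] := dsum_covers_seq q (fun i => sigma (n i)).
have /choice[g hg] : forall i : {classic L}, exists g : {linear N -> M},
    forall x, g x = sigma x i.
  by move=> i; apply: bundle_linear => a x y; rewrite linearP dsum_valP.
have /choice[f hf] : forall i : {classic L}, exists f : {linear M -> N},
    forall x, f x = rho (dsum_in i x).
  by move=> i; apply: bundle_linear => a x y; rewrite dsum_in_linear linearP.
case: s hs => [|i0 s] hs.
  exists 0%N, (fun=> \0%R), (fun=> \0%R) => i iq; rewrite big_ord0 -[RHS]rs.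
  by rewrite (dsum_sum_in (hs i iq)) big_nil linear0.
exists (size (i0 :: s)), (fun j => f (nth i0 (i0 :: s) j)), (fun j => g (nth i0 (i0 :: s) j)).
move=> i iq; rewrite -[RHS]rs (dsum_sum_in (hs i iq)) linear_sum.
by rewrite (big_nth i0) big_mkord; apply: eq_bigr => j _; rewrite hf hg.
Qed.

(** * Descent of homomorphisms *)

Section SequenceSpan.
Variables (R : pzRingType) (V W : lmodType R).

Definition fspan (e : nat -> V) (n : nat) : set V :=
  [set y | exists c : nat -> R, y = \sum_(i < n) c i *: e i].

(** Homomorphisms on a submodule A are kept as total functions whose values
    outside A are arbitrary: the stages of an increasing union are then all
    subsets of one type. *)
Definition linear_on (A : set V) (h : V -> W) : Prop :=
  forall a x y, A x -> A y -> h (a *: x + y) = a *: h x + h y.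

Lemma fspan_lin e n a x y : fspan e n x -> fspan e n y -> fspan e n (a *: x + y).
Proof.
move=> [c ->] [d ->]; exists (fun i => a * c i + d i).
rewrite scaler_sumr -big_split; apply: eq_bigr => i _ /=.
by rewrite scalerA scalerDl.
Qed.

Lemma fspan0 e n : fspan e n 0.
Proof. by exists (fun=> 0); rewrite big1 // => i _; rewrite scale0r. Qed.

Lemma fspan_sum e n k (c : nat -> R) (x : nat -> V) :
  (forall i, (i < k)%N -> fspan e n (x i)) -> fspan e n (\sum_(i < k) c i *: x i).
Proof.
elim: k => [|k IH] h; first by rewrite big_ord0; apply: fspan0.
rewrite big_ord_recr /= addrC; apply: fspan_lin; first exact: h.
by apply: IH => i ik; apply: h; rewrite ltnS ltnW.
Qed.

Lemma fspan_big e n k (c : 'I_k -> R) (x : 'I_k -> V) :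
  (forall i, fspan e n (x i)) -> fspan e n (\sum_(i < k) c i *: x i).
Proof.
by move=> hx; elim/big_rec: _ => [|i y _]; [exact: fspan0 | exact: fspan_lin].
Qed.

Lemma fspan_gen e n i : (i < n)%N -> fspan e n (e i).
Proof.
move=> ilt; exists (fun j => (j == i)%:R).
rewrite (bigD1 (Ordinal ilt)) //= eqxx scale1r big1 ?addr0 // => j.
by rewrite -val_eqE /= => /negPf ->; rewrite scale0r.
Qed.

Lemma fspan_le e n k : (n <= k)%N -> fspan e n `<=` fspan e k.
Proof.
move=> nk _ [c ->]; apply: fspan_sum => i ilt.
by apply: fspan_gen; apply: leq_trans nk.
Qed.

Lemma linear_on_sum e n h k (c : nat -> R) (x : nat -> V) :
  linear_on (fspan e n) h -> (forall i, (i < k)%N -> fspan e n (x i)) ->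
  h (\sum_(i < k) c i *: x i) = \sum_(i < k) c i *: h (x i).
Proof.
move=> lin_h; elim: k => [|k IH] hx.
  rewrite !big_ord0; have := lin_h 1 0 0 (fspan0 e n) (fspan0 e n).
  by rewrite !scale1r addr0 => /(congr1 (fun z => z - h 0)); rewrite subrr addrK.
have hx' i : (i < k)%N -> fspan e n (x i) by move=> ik; apply: hx; rewrite ltnS ltnW.
rewrite !big_ord_recr /= addrC lin_h ?IH //; first by rewrite addrC.
- exact: hx.
- exact: fspan_sum.
Qed.

Lemma fspan_extend (e : nat -> V) n (v : nat -> W) :
  (forall c : nat -> R, \sum_(i < n) c i *: e i = 0 -> \sum_(i < n) c i *: v i = 0) ->
  exists h : V -> W, linear_on (fspan e n) h /\
    forall c : nat -> R, h (\sum_(i < n) c i *: e i) = \sum_(i < n) c i *: v i.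
Proof.
move=> rel.
have /choice[c hc] : forall y, exists c : nat -> R, fspan e n y ->
    y = \sum_(i < n) c i *: e i.
  move=> y; have [[c yE]|ny] := pselect (fspan e n y); first by exists c.
  by exists (fun=> 0).
pose h y := \sum_(i < n) c y i *: v i.
have hE (d : nat -> R) : h (\sum_(i < n) d i *: e i) = \sum_(i < n) d i *: v i.
  pose y := \sum_(i < n) d i *: e i; rewrite -/y /h.
  apply/eqP; rewrite -subr_eq0 -sumrB; apply/eqP.
  under eq_bigr do rewrite -scalerBl.
  apply: (rel (fun i => c y i - d i)).
  under eq_bigr do rewrite scalerBl.
  by rewrite sumrB -hc ?subrr //; exists d.
exists h; split=> // a _ _ [d ->] [d' ->].
rewrite !hE -[RHS](_ : \sum_(i < n) (a * d i + d' i) *: v i = _); last first.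
  rewrite scaler_sumr -big_split; apply: eq_bigr => i _ /=.
  by rewrite scalerDl scalerA.
rewrite -(hE (fun i => a * d i + d' i)); congr h.
rewrite scaler_sumr -big_split; apply: eq_bigr => i _ /=.
by rewrite scalerDl scalerA.
Qed.

End SequenceSpan.

Lemma common_bound (P : nat -> nat -> Prop) N :
  (forall i k l, (k <= l)%N -> P i k -> P i l) ->
  (forall i, (i < N)%N -> exists k, P i k) ->
  exists k, forall i, (i < N)%N -> P i k.
Proof.
move=> mono; elim: N => [|N IH] h; first by exists 0%N.
have [|k hk] := IH; first by move=> i iN; apply: h; rewrite ltnS ltnW.
have [l hl] := h N (leqnn _); exists (maxn k l) => i.
rewrite ltnS leq_eqVlt => /orP[/eqP ->|/hk].
  exact: mono (leq_maxr _ _) hl.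
exact: mono (leq_maxl _ _).
Qed.

Section HomDescent.
Variables (R : idomainType) (S : comPzRingType) (phi : {rmorphism R -> S}).
Hypothesis dphi : dense_extension phi.
Variable X : lmodType R.
Local Notation "x ⊗ s" := (tensor phi x s) (at level 40).

Lemma dense_flat_system_fin (I : finType) Q (x : nat -> I -> X) (s : I -> S) :
  (forall f, (f < Q)%N -> \sum_i s i *: (x f i ⊗ 1) = 0) ->
  exists (p : nat) (B : nat -> I -> R) (u : nat -> S),
    (forall f q, (f < Q)%N -> (q < p)%N -> \sum_i B q i *: x f i = 0) /\
    (forall i, s i = \sum_(q < p) u q * phi (B q i)).
Proof.
move=> hs.
pose ext (V : zmodType) (F : I -> V) k : V :=
  if insub k is Some i then F (@enum_val I predT i) else 0.
have extE (V : zmodType) (F : I -> V) (i : 'I_#|I|) : ext V F i = F (enum_val i).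
  by rewrite /ext valK.
have [f fQ|p [B [u [Bx su]]]] := @dense_flat_system _ _ _ dphi X Q #|I|
    (fun f => ext _ (x f)) (ext _ s).
  rewrite -[RHS](hs f fQ) [RHS](reindex _ (onW_bij _ (@enum_val_bij I))).
  by apply: eq_bigr => i _; rewrite !extE.
exists p, (fun q i => B q (enum_rank i)), u; split=> [f q fQ qp|i].
  rewrite -[RHS](Bx f q fQ qp) [LHS](reindex _ (onW_bij _ (@enum_val_bij I))).
  by apply: eq_bigr => i _; rewrite extE enum_valK.
by rewrite -su // -[in LHS](enum_rankK i) -extE.
Qed.

(** On the span of a 0, ..., a (n-1), a homomorphism to S \otimes X is an
    S-combination of homomorphisms to X.  The values h (a i) have to satisfy
    the relations of the a i, of which finitely many imply the others
    ([finite_rank_relations]); by flatness the matrix of coefficients s is a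
    combination of matrices over R that satisfy these relations too. *)
Lemma semilinear_descent (A : lmodType R) (a : nat -> A) (n : nat)
    (h : A -> base_change phi X) : torsion_free X -> semilinear_map phi h ->
  exists (p : nat) (u : nat -> S) (hp : nat -> A -> X),
    (forall k, (k < p)%N -> linear_on (fspan a n) (hp k)) /\
    forall y, fspan a n y -> h y = \sum_(k < p) u k *: (hp k y ⊗ 1).
Proof.
move=> tfX hS.
have [N [x [s hxs]]] : exists N (x : nat -> nat -> X) (s : nat -> nat -> S),
    forall i, (i < n)%N -> h (a i) = \sum_(j < N) s i j *: (x i j ⊗ 1).
  have [N hN] : exists N, forall i, (i < n)%N -> exists (xs : (nat -> X) * (nat -> S)),
      h (a i) = \sum_(j < N) xs.2 j *: (xs.1 j ⊗ 1).
    apply: (@common_bound (fun i N => exists (xs : (nat -> X) * (nat -> S)),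
      h (a i) = \sum_(j < N) xs.2 j *: (xs.1 j ⊗ 1))) => [i k l kl [[x s] /= ->]|i _].
      exists (x, fun j => if (j < k)%N then s j else 0) => /=.
      rewrite (big_ord_widen l (fun j => s j *: (x j ⊗ 1)) kl) big_mkcond.
      by apply: eq_bigr => j _; case: ifP => // _; rewrite scale0r.
    by have [k [x [s ->]]] := base_change_sum (h (a i)); exists k, (x, s).
  have /choice[xs hxs] : forall i, exists (xs : (nat -> X) * (nat -> S)), (i < n)%N ->
      h (a i) = \sum_(j < N) xs.2 j *: (xs.1 j ⊗ 1).
    move=> i; have [/hN[xs hi]|_] := boolP (i < n)%N; first by exists xs.
    by exists (fun=> 0, fun=> 0).
  by exists N, (fun i => (xs i).1), (fun i => (xs i).2).
pose rels := {c : nat -> R | \sum_(i < n) c i *: a i = 0}.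
have rel0 : \sum_(i < n) (0 : R) *: a i = 0.
  by rewrite big1 // => i _; rewrite scale0r.
pose c0 : rels := exist _ (fun=> 0) rel0.
have [ls hls] := finite_rank_relations n (fun i (l : rels) => sval l i).
have tS := @tensor_semilinear _ _ phi X.
have [f fQ|p [B [u [Bx su]]]] := @dense_flat_system_fin ('I_n * 'I_N)%type (size ls)
   (fun f ij => sval (nth (c0 : {classic rels}) ls f) ij.1 *: x ij.1 ij.2)
   (fun ij => s ij.1 ij.2).
  transitivity (h (\sum_(i < n) sval (nth (c0 : {classic rels}) ls f) i *: a i)).
    2: by rewrite (svalP (nth (c0 : {classic rels}) ls f)) (semilinear0 hS).
  rewrite (semilinear_sum hS) -(pair_bigA _ (fun i j => s (val i) (val j) *:
     ((sval (nth (c0 : {classic rels}) ls f) (val i) *: x (val i) (val j)) ⊗ 1))) /=.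
  apply: eq_bigr => i _; rewrite (semilinearZ hS) hxs // scaler_sumr.
  by apply: eq_bigr => j _; rewrite (semilinearZ tS) !scalerA mulrC.
pose Bn q (i j : nat) : R :=
  if insub i is Some i' then if insub j is Some j' then B q (i', j') else 0 else 0.
have BnE q (i : 'I_n) (j : 'I_N) : Bn q i j = B q (i, j) by rewrite /Bn !valK.
pose v q i := \sum_(j < N) Bn q i j *: x i j.
have relv q : (q < p)%N -> forall c : nat -> R, \sum_(i < n) c i *: a i = 0 ->
    \sum_(i < n) c i *: v q i = 0.
  move=> qp c hc; apply: (hls X (v q) tfX _ (exist _ c hc)) => l lls.
  have := Bx (index l ls) q; rewrite index_mem nth_index // => /(_ lls qp) h0.
  rewrite -[RHS]h0.
  under eq_bigr do rewrite scaler_sumr.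
  rewrite pair_bigA; apply: eq_bigr => -[i j] _ /=.
  by rewrite BnE !scalerA mulrC.
have /choice[hp hhp] : forall q, exists hq : A -> X, (q < p)%N ->
    linear_on (fspan a n) hq /\
    forall c : nat -> R, hq (\sum_(i < n) c i *: a i) = \sum_(i < n) c i *: v q i.
  move=> q; have [/relv/fspan_extend[hq hhq]|_] := boolP (q < p)%N; first by exists hq.
  by exists (fun=> 0).
exists p, u, hp; split=> [k /hhp[] //|y [c ->]].
rewrite (semilinear_sum hS).
transitivity (\sum_(i < n) \sum_(k < p) u k *: ((c i *: v k i) ⊗ 1)).
  apply: eq_bigr => i _; rewrite (semilinearZ hS) hxs // scaler_sumr.
  under [RHS]eq_bigr do rewrite (semilinearZ tS) (semilinear_sum tS) !scaler_sumr.
  rewrite exchange_big; apply: eq_bigr => j _ /=.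
  rewrite (su (i, j)) scaler_suml scaler_sumr; apply: eq_bigr => k _.
  rewrite BnE (semilinearZ tS) !scalerA; congr (_ *: _).
  by rewrite mulrCA mulrA.
rewrite exchange_big; apply: eq_bigr => k _ /=.
by rewrite (proj2 (hhp k _)) // (semilinear_sum tS) scaler_sumr.
Qed.

(** A sequence in X stands for the values of an endomorphism of X at generators,
    of which the first Q are compared. *)
Definition tensor_span (Q : nat) (E : set (nat -> X)) : set (nat -> base_change phi X) :=
  [set w | exists p (u : nat -> S) (e : nat -> nat -> X),
     (forall q, (q < p)%N -> E (e q)) /\
     forall i, (i < Q)%N -> w i = \sum_(q < p) u q *: (e q i ⊗ 1)].

Lemma tensor_span_in Q (E : set (nat -> X)) e : E e ->
  tensor_span Q E (fun i => e i ⊗ 1).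
Proof.
move=> Ee; exists 1%N, (fun=> 1), (fun=> e); split=> // i _.
by rewrite big_ord1 scale1r.
Qed.

Lemma tensor_span_sum Q (E : set (nat -> X)) k (t : nat -> S)
    (F : nat -> nat -> base_change phi X) (w : nat -> base_change phi X) :
  (forall j, (j < k)%N -> tensor_span Q E (F j)) ->
  (forall i, (i < Q)%N -> w i = \sum_(j < k) t j *: F j i) -> tensor_span Q E w.
Proof.
elim: k w => [|k IH] w hF hw.
  by exists 0%N, (fun=> 0), (fun _ _ => 0); split=> // i /hw; rewrite !big_ord0.
have [||p [u [e [Ee he]]]] := IH (fun i => \sum_(j < k) t j *: F j i).
- by move=> j jk; apply: hF; rewrite ltnS ltnW.
- by [].
have [p' [u' [e' [Ee' he']]]] := hF k (leqnn _).
exists (p + p')%N, (fun q => if (q < p)%N then u q else t k * u' (q - p)%N),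
  (fun q => if (q < p)%N then e q else e' (q - p)%N); split=> [q qp|i iQ].
  case: ifPn => [/Ee //|]; rewrite -leqNgt => pq; apply: Ee'.
  by rewrite ltn_subLR.
rewrite hw // big_ord_recr /= he // he' // big_split_ord /=; congr (_ + _).
  by apply: eq_bigr => q _; rewrite ltn_ord.
rewrite scaler_sumr; apply: eq_bigr => q _.
by rewrite ltnNge leq_addr addKn scalerA.
Qed.

Lemma dense_faithful_span Q (E : set (nat -> X)) (w : nat -> X) :
  E (fun=> 0) ->
  (forall a e e', E e -> E e' -> E (fun i => a *: e i + e' i)) ->
  tensor_span Q E (fun i => w i ⊗ 1) ->
  exists2 e, E e & forall i, (i < Q)%N -> w i = e i.
Proof.
move=> E0 ED [p [u [e [Ee /(dense_faithful dphi)[c hc]]]]].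
exists (fun i => \sum_(q < p) c q *: e q i) => //.
elim: (p) Ee => [|k IH] Ee.
  by rewrite (_ : (fun=> _) = fun=> 0) //; apply/funext => i; rewrite big_ord0.
rewrite (_ : (fun=> _) = fun i => c k *: e k i + \sum_(q < k) c q *: e q i); last first.
  by apply/funext => i; rewrite big_ord_recr /= addrC.
by apply: ED; [exact: Ee | apply: IH => q qk; apply: Ee; rewrite ltnS ltnW].
Qed.

End HomDescent.

(** * Descent of direct summands *)

Lemma sum_iota (V : nmodType) n (F : nat -> V) :
  \sum_(i <- iota 0 n) F i = \sum_(i < n) F i.
Proof. by rewrite -(big_mkord xpredT) /index_iota subn0. Qed.

Section LocallySplit.
Variables (R : pzRingType) (M X : lmodType R).

(** Every element is fixed by an endomorphism that factors through a finite
    power of M; for M = R this is local projectivity. *)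
Definition locally_split : Prop := forall x : X,
  exists k (f : nat -> {linear M -> X}) (g : nat -> {linear X -> M}),
    \sum_(j < k) f j (g j x) = x.

(** Let phi_n be an endomorphism that factors through a power of M and fixes
    theta_n (e n), where theta_n = (1 - phi_(n-1)) ... (1 - phi_0).  Then theta_n
    kills e 0, ..., e (n-1), and phi_i theta_i telescopes to 1 - theta_n when
    summed over i < n.  So the maps phi_i theta_i, finitely many of which are
    nonzero at a given point, add up to the identity of X, and they factor
    through the direct sum of the powers of M. *)
Lemma locally_split_in_Add (e : nat -> X) :
  (forall x, exists n, fspan e n x) -> locally_split -> in_Add M X.
Proof.
move=> gen_e /choice[k /choice[f /choice[g fg]]].
pose step n (theta : {linear X -> X}) : X -> X := fun x =>
  theta x - \sum_(j < k (theta (e n))) f (theta (e n)) j (g (theta (e n)) j (theta x)).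
have /choice[next hnext] : forall nt : nat * {linear X -> X},
    exists t : {linear X -> X}, forall x, t x = step nt.1 nt.2 x.
  move=> [n t] /=; apply: bundle_linear => a x y; rewrite /step linearP.
  under eq_bigr do rewrite !linearP.
  by rewrite big_split -scaler_sumr scalerBr /= opprD addrACA.
pose theta := fix theta n : {linear X -> X} :=
  if n is n'.+1 then next (n', theta n') else idfun.
pose K n := k (theta n (e n)).
pose F n j : {linear M -> X} := f (theta n (e n)) j.
pose G n j x : M := g (theta n (e n)) j (theta n x).
have thetaS n x : theta n.+1 x = theta n x - \sum_(j < K n) F n j (G n j x).
  exact: hnext.
have theta_tel n x : \sum_(i < n) \sum_(j < K i) F i j (G i j x) = x - theta n x.
  elim: n => [|n IH]; first by rewrite big_ord0 /= subrr.
  by rewrite big_ord_recr /= IH thetaS opprB addrA addrAC.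
have theta0 n i : (i < n)%N -> theta n (e i) = 0.
  elim: n => // n IH; rewrite ltnS leq_eqVlt thetaS => /orP[/eqP ->|/IH h].
    by rewrite /F /G fg subrr.
  rewrite h big1 ?subr0 // => j _; by rewrite /G h !linear0.
have theta_span n x i : fspan e n x -> (n <= i)%N -> theta i x = 0.
  move=> [c ->] ni; rewrite linear_sum big1 // => j _.
  by rewrite linearZ /= theta0 ?scaler0 // (leq_trans _ ni).
(* the summands of the direct sum are indexed by pairs (n, j) with j < K n *)
pose coord x (nj : nat * nat) : M :=
  if (nj.2 < K nj.1)%N then G nj.1 nj.2 x else 0.
have coord_lin a x y nj : coord (a *: x + y) nj = a *: coord x nj + coord y nj.
  by rewrite /coord /G; case: ifP; rewrite ?linearP // scaler0 addr0.
pose cells n : seq {classic (nat * nat)} :=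
  [seq (i, j) : {classic (nat * nat)} | i <- iota 0 n, j <- iota 0 (K i)].
have cellsP n i j : ((i, j) : {classic (nat * nat)}) \in cells n = (i < n)%N && (j < K i)%N.
  apply/allpairsPdep/andP => [[i' [j']]|[ilt jlt]].
    by rewrite !mem_iota /= !add0n => -[ilt jlt [-> ->]].
  by exists i, j; rewrite !mem_iota.
have cells_uniq n : uniq (cells n).
  apply: allpairs_uniq_dep => [|i _|[i j] [i' j'] _ _ /= [-> ->]] //;
    exact: iota_uniq.
have coord0 n x : fspan e n x -> forall nj : {classic (nat * nat)},
    nj \notin cells n -> coord x nj = 0.
  move=> nx [i j]; rewrite cellsP negb_and /coord /=.
  case: ifP => // _; rewrite orbF -leqNgt => ni.
  by rewrite /G (theta_span n x i nx ni) linear0.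
have /choice[sigma sigmaE] : forall x, exists s : dsum (nat * nat) M,
    forall nj, s nj = coord x nj.
  by move=> x; have [n nx] := gen_e x; apply: (dsum_mk (s := cells n)); apply: coord0.
pose h (nj : nat * nat) (v : M) : X := F nj.1 nj.2 v.
have lin_h nj : linear (h nj) by move=> a v w; rewrite /h linearP.
apply: (@in_Add_retract _ _ _ _ sigma (dsum_out h)).
- by move=> a x y; apply: dsum_ext => nj; rewrite dsum_valP !sigmaE coord_lin.
- exact: dsum_out_linear.
move=> x; have [n nx] := gen_e x.
rewrite (dsum_outE lin_h (s := cells n)); last first.
  split=> // nj; rewrite sigmaE => cnj; apply: contrapT => /negP nin.
  by apply: cnj; apply: coord0 nin.
rewrite big_allpairs_dep /=.
rewrite -[RHS](_ : x - theta n x = x); last by rewrite (theta_span n x n nx) // subr0.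
rewrite -theta_tel.
rewrite sum_iota; apply: eq_bigr => i _.
rewrite sum_iota; apply: eq_bigr => j _.
by rewrite sigmaE /coord /= ltn_ord.
Qed.

End LocallySplit.

Section AddDescent.
Variables (R : idomainType) (S : comPzRingType) (phi : {rmorphism R -> S}).
Hypothesis dphi : dense_extension phi.
Variables (M X : lmodType R) (gM : nat -> M) (nM : nat) (e : nat -> X).
Hypotheses (gen_M : forall y, fspan gM nM y) (tfM : torsion_free M).
Hypotheses (gen_e : forall x, exists n, fspan e n x) (tfX : torsion_free X).
Hypothesis AddX : in_Add (base_change phi M) (base_change phi X).
Local Notation "x ⊗ s" := (tensor phi x s) (at level 40).
Local Notation Xn := (fspan e).

Lemma stage_bound N (y : nat -> X) : exists m, forall i, (i < N)%N -> Xn m (y i).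
Proof.
apply: (@common_bound (fun i m => Xn m (y i))) => [i k l kl|i _]; last exact: gen_e.
exact: fspan_le.
Qed.

(** The maps g j are defined on the stage l only, whereas the images of the maps
    f j are bounded by the stage m. *)
Definition splits_stage n m l : Prop :=
  exists k (f : nat -> {linear M -> X}) (g : nat -> X -> M),
    [/\ forall j y, (j < k)%N -> Xn m (f j y),
        forall j, (j < k)%N -> linear_on (Xn l) (g j) &
        forall y, Xn n y -> \sum_(j < k) f j (g j y) = y].

Lemma base_change_map_descent (h : {linear base_change phi M -> base_change phi X}) :
  exists p (u : nat -> S) (f : nat -> {linear M -> X}) m,
    (forall k y, (k < p)%N -> Xn m (f k y)) /\
    forall y, h (y ⊗ 1) = \sum_(k < p) u k *: (f k y ⊗ 1).
Proof.
have hS : semilinear_map phi (fun y : M => h (y ⊗ 1)).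
  by move=> a x y; rewrite (@tensor_semilinear _ _ phi M) linearP.
have [p [u [hp [lin_hp hE]]]] := semilinear_descent dphi gM nM tfX hS.
have /choice[f fE] : forall k, exists f : {linear M -> X}, (k < p)%N -> forall y, f y = hp k y.
  move=> k; have [kp|_] := boolP (k < p)%N; last by exists \0.
  have [|f fE] := @bundle_linear _ _ _ (hp k); last by exists f.
  by move=> a x y; apply: (lin_hp k kp).
have [m hm] : exists m, forall k, (k < p)%N -> forall y, Xn m (f k y).
  apply: (@common_bound (fun k m => forall y, Xn m (f k y))) => [i k l kl hk y|k _].
    exact: fspan_le kl _ (hk y).
  have [m hm] := stage_bound nM (fun i => f k (gM i)).
  exists m => y; have [c ->] := gen_M y.
  rewrite linear_sum; under eq_bigr do rewrite linearZ /=.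
  exact: (@fspan_sum _ _ e m nM c (fun i => f k (gM i))) hm.
exists p, u, f, m; split=> [k y kp|y]; first exact: hm.
by rewrite hE //; apply: eq_bigr => k _; rewrite fE.
Qed.

(** Over S the identity of the stage n factors through finitely many copies of
    S \otimes M.  The finitely many maps from M to S \otimes X that occur descend
    first, and they determine m; then, for each l, the maps from the stage l to
    S \otimes M descend.  So the identity of the stage n is an S-combination of
    composites over R, hence one of them by [dense_faithful_span]. *)
Lemma splits_stage_exists n : exists m, forall l, (n <= l)%N -> splits_stage n m l.
Proof.
have [k [fh [gh fgE]]] := in_Add_factor AddX n (fun i => e i ⊗ 1).
have /choice[p /choice[u /choice[f /choice[mj hf]]]] := fun j => base_change_map_descent (fh j).
have [m hm] : exists m, forall j, (j < k)%N -> (mj j <= m)%N.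
  apply: (@common_bound (fun j m => (mj j <= m)%N)) => [i a b ab h|j _].
    exact: leq_trans ab.
  by exists (mj j).
exists m => l nl.
pose E : set (nat -> X) := [set w | exists k (f : nat -> {linear M -> X}) (g : nat -> X -> M),
    [/\ forall j y, (j < k)%N -> Xn m (f j y),
        forall j, (j < k)%N -> linear_on (Xn l) (g j) &
        forall i, w i = \sum_(j < k) f j (g j (e i))]].
have [|||w [k' [f' [g' [hf' hg' wE]]]] we] :=
    @dense_faithful_span _ _ _ dphi X n E e.
- exists 0%N, (fun=> \0%R), (fun _ _ => 0); split=> // i; by rewrite big_ord0.
- move=> a w w' [k1 [f1 [g1 [hf1 hg1 w1]]]] [k2 [f2 [g2 [hf2 hg2 w2]]]].
  exists (k1 + k2)%N, (fun j => if (j < k1)%N then f1 j else f2 (j - k1)%N),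
    (fun j x => if (j < k1)%N then a *: g1 j x else g2 (j - k1)%N x).
  split=> [j y jk|j jk|i].
  + case: ifPn => [jk1|]; first exact: hf1.
    by rewrite -leqNgt => jk1; apply: hf2; rewrite ltn_subLR.
  + move=> b x y hx hy; case: ifPn => [jk1|].
      by rewrite hg1 // scalerDr !scalerA mulrC.
    by rewrite -leqNgt => jk1; apply: hg2; rewrite ?ltn_subLR.
  + rewrite w1 w2 big_split_ord /= scaler_sumr; congr (_ + _).
      by apply: eq_bigr => j _; rewrite ltn_ord linearZ.
    by apply: eq_bigr => j _; rewrite ltnNge leq_addr addKn.
- apply: (@tensor_span_sum _ _ phi X n E k (fun=> 1) (fun j i => fh j (gh j (e i ⊗ 1)))).
    move=> j jk.
    have hS : semilinear_map phi (fun y : X => gh j (y ⊗ 1)).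
      by move=> a x y; rewrite (@tensor_semilinear _ _ phi X) linearP.
    have [r [v [g [lin_g gE]]]] := semilinear_descent dphi e l tfM hS.
    apply: (@tensor_span_sum _ _ phi X n E r v (fun q i => fh j (g q (e i) ⊗ 1))).
      move=> q qr; have [hfm hfE] := hf j.
      apply: (@tensor_span_sum _ _ phi X n E (p j) (u j) (fun t i => f j t (g q (e i)) ⊗ 1)).
        move=> t tp; apply: (@tensor_span_in _ _ phi X n E (fun i => f j t (g q (e i)))).
        exists 1%N, (fun=> f j t), (fun=> g q); split=> [_ y _|_ _|i].
        - exact: fspan_le (hm j jk) _ (hfm _ _ tp).
        - exact: lin_g.
        - by rewrite big_ord1.
      by move=> i _; rewrite hfE.
    move=> i iln; rewrite gE; last by apply: fspan_gen; apply: leq_trans nl.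
    by rewrite linear_sum; apply: eq_bigr => q _; rewrite linearZ.
  move=> i iln; rewrite -[LHS](fgE i iln).
  by apply: eq_bigr => j _; rewrite scale1r.
exists k', f', g'; split=> // y [c ->].
have lin_e i : (i < n)%N -> Xn l (e i).
  by move=> iln; apply: fspan_gen; apply: leq_trans nl.
transitivity (\sum_(j < k') \sum_(i < n) c i *: f' j (g' j (e i))).
  apply: eq_bigr => j _; rewrite (linear_on_sum _ (hg' j _)) // linear_sum.
  by apply: eq_bigr => i _; rewrite linearZ.
rewrite exchange_big; apply: eq_bigr => i _ /=.
by rewrite -scaler_sumr -wE -we.
Qed.

(** Mittag-Leffler argument.  Along stages N 0 = n, N 1, ... such that N i splits
    with maps f j into N (i+1), a map h on N (i+1) is replaced by the sum of the
    h f j g j, defined on N (i+2), without changing it on N i.  The limit of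
    the maps obtained in this way is defined on X. *)
Lemma stage_map_extends n : exists n1, (n <= n1)%N /\ forall h : X -> M,
  linear_on (Xn n1) h ->
  exists g : {linear X -> M}, forall y, Xn n y -> g y = h y.
Proof.
have /choice[m hm] := splits_stage_exists.
pose N := fix N i := if i is i'.+1 then maxn (m (N i')) (N i').+1 else n.
have NS i : (N i < N i.+1)%N by rewrite /= leq_maxr.
have mN i : (m (N i) <= N i.+1)%N by rewrite /= leq_maxl.
have Nle i j : (i <= j)%N -> (N i <= N j)%N.
  elim: j => [|j IH]; first by rewrite leqn0 => /eqP ->.
  rewrite leq_eqVlt => /orP[/eqP -> //|]; rewrite ltnS => /IH h.
  exact: leq_trans h (ltnW (NS j)).
have Nge i : (i <= N i)%N by elim: i => // i IH; apply: leq_ltn_trans (NS i).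
exists (N 1%N); split; first exact: (Nle 0%N).
move=> h0 lin_h0.
have /choice[next hnext] : forall ih : nat * (X -> M), exists h' : X -> M,
    linear_on (Xn (N ih.1.+1)) ih.2 ->
    linear_on (Xn (N ih.1.+2)) h' /\ forall y, Xn (N ih.1) y -> h' y = ih.2 y.
  move=> [i h] /=; have [lin_h|] := pselect (linear_on (Xn (N i.+1)) h); last by exists h.
  have [k [f [g [hf lin_g fgE]]]] := hm (N i) (N i.+2) (Nle i i.+2 (leqW (leqnSn i))).
  exists (fun y => \sum_(j < k) h (f j (g j y))) => _.
  have hf' j y : (j < k)%N -> Xn (N i.+1) (f j y).
    by move=> jk; apply: fspan_le (mN i) _ _; apply: hf.
  split=> [a x y hx hy|y hy].
    rewrite scaler_sumr -big_split; apply: eq_bigr => j _ /=.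
    rewrite lin_g // linearP lin_h //; exact: hf'.
  rewrite -[in RHS](fgE y hy).
  have := @linear_on_sum _ _ _ e (N i.+1) h k (fun=> 1) (fun j => f j (g j y)) lin_h.
  under eq_bigr do rewrite scale1r.
  move=> -> => [|j jk]; last exact: hf'.
  by apply: eq_bigr => j _; rewrite scale1r.
pose H := fix H i := if i is i'.+1 then next (i', H i') else h0.
have lin_H i : linear_on (Xn (N i.+1)) (H i).
  by elim: i => // i IH; case: (hnext (i, H i) IH).
have HS i y : Xn (N i) y -> H i.+1 y = H i y.
  by case: (hnext (i, H i) (lin_H i)) => _ h /h.
have HD i j y : Xn (N i) y -> H (i + j)%N y = H i y.
  move=> hy; elim: j => [|j IH]; first by rewrite addn0.
  by rewrite addnS HS //; apply: fspan_le hy; apply: Nle; apply: leq_addr.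
have /choice[idx hidx] : forall y, exists i, Xn (N i) y.
  move=> y; have [i hi] := gen_e y; exists i.
  exact: fspan_le (Nge i) _ hi.
have HE i y : Xn (N i) y -> H (idx y) y = H i y.
  move=> hy; rewrite -(HD (idx y) i y (hidx y)) -(HD i (idx y) y hy).
  by rewrite addnC.
have [|g gE] := @bundle_linear _ _ _ (fun y => H (idx y) y).
  move=> a x y; set i := maxn (idx x) (idx y).
  have hx : Xn (N i) x by apply: fspan_le (hidx x); apply: Nle; apply: leq_maxl.
  have hy : Xn (N i) y by apply: fspan_le (hidx y); apply: Nle; apply: leq_maxr.
  have le_i := ltnW (NS i).
  rewrite (HE i (a *: x + y) (fspan_lin _ hx hy)) (HE i x hx) (HE i y hy).
  by rewrite (lin_H i) //; apply: fspan_le le_i _ _.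
by exists g => y hy; rewrite gE (HE 0%N).
Qed.

Theorem Add_descent : in_Add M X.
Proof.
apply: (locally_split_in_Add gen_e) => x.
have [n nx] := gen_e x.
have [n1 [nn1 hn1]] := stage_map_extends n.
have [m hm] := splits_stage_exists n.
have [k [f [g [_ lin_g fgE]]]] := hm n1 nn1.
have /choice[g' hg'] : forall j, exists g' : {linear X -> M}, (j < k)%N ->
    forall y, Xn n y -> g' y = g j y.
  move=> j; have [jk|_] := boolP (j < k)%N; last by exists \0.
  by have [g' hg'] := hn1 _ (lin_g j jk); exists g'.
exists k, f, g'; rewrite -[RHS](fgE x nx).
by apply: eq_bigr => j _; rewrite hg'.
Qed.

End AddDescent.

(** * Isomorphisms and countable generation *)

Lemma isomorphic_bij (R : pzRingType) (V W : lmodType R) (f : V -> W) :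
  linear f -> (forall x, f x = 0 -> x = 0) -> (forall y, exists x, f x = y) ->
  isomorphic V W /\ isomorphic W V.
Proof.
move=> /bundle_linear[F FE] inj /choice[g fg].
have Fg y : F (g y) = y by rewrite FE fg.
have gF x : g (F x) = x.
  by apply/eqP; rewrite -subr_eq0; apply/eqP/inj; rewrite -FE linearB Fg subrr.
have [|G GE] := @bundle_linear _ _ _ g.
  by move=> a x y; apply: (can_inj gF); rewrite linearP !Fg.
split; first by exists F; exists g.
by exists G; exists F => x; rewrite GE.
Qed.

Lemma isomorphic_sections (R : pzRingType) (V W : lmodType R) : isomorphic V W ->
  exists (f : {linear V -> W}) (g : {linear W -> V}), cancel f g /\ cancel g f.
Proof.
move=> [f [g fg gf]]; have [|g' gE] := @bundle_linear _ _ _ g.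
  by move=> a x y; apply: (can_inj fg); rewrite linearP !gf.
by exists f, g'; split=> x; rewrite gE.
Qed.

Lemma in_Add_isomorphic (R : pzRingType) (M V W : lmodType R) :
  isomorphic V W -> in_Add M V -> in_Add M W.
Proof.
move=> /isomorphic_sections[f [g [fg gf]]] /in_Add_section[L [s [r rs]]].
apply: (@in_Add_retract _ _ _ L (fun x => s (g x)) (fun z => f (r z))).
- by move=> a x y; rewrite !linearP.
- by move=> a x y; rewrite !linearP.
- by move=> x; rewrite rs gf.
Qed.

Section CountableGeneration.
Variables (R : pzRingType) (V : lmodType R).

Lemma countably_generated_seq : countably_generated V ->
  exists e : nat -> V, forall v, exists n, fspan e n v.
Proof.
move=> [A [/countable_injP[f finj] spanA]].
have /choice[e he] : forall k, exists v : V, forall a, A a -> f a = k -> a = v.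
  move=> k; have [[v [Av <-]]|h] := pselect (exists v, A v /\ f v = k).
    by exists v => a Aa /finj; apply; rewrite inE.
  by exists 0 => a Aa fa; case: h; exists a.
exists e => v; have : Defs.span A v by rewrite spanA.
move=> [n [c [x [Ax ->]]]]; exists (\max_(i < n) (f (x i)).+1)%N.
apply: fspan_big => i; rewrite (he _ _ (Ax i) erefl); apply: fspan_gen.
exact: (leq_bigmax i).
Qed.

Lemma seq_countably_generated (e : nat -> V) :
  (forall v, exists n, fspan e n v) -> countably_generated V.
Proof.
move=> gen; exists (range e); split.
  by apply: card_le_trans (card_image_le _ _) _; exact: countableP.
apply/seteqP; split=> // v _; have [n [c ->]] := gen v.
by exists n, (fun i => c (val i)), (fun i => e (val i)).
Qed.

Lemma finitely_generated_seq : finitely_generated V ->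
  exists (e : nat -> V) n, forall v, fspan e n v.
Proof.
move=> [A [finA spanA]].
have [s As] : exists s : seq V, A = [set` s] by apply/finite_seqP.
exists (fun i => s`_i), (size s) => v; have : Defs.span A v by rewrite spanA.
move=> [n [c [x [Ax ->]]]].
apply: fspan_big => i; have xs : x i \in s by have := Ax i; rewrite As.
rewrite -(nth_index 0 xs); apply: fspan_gen.
by rewrite index_mem.
Qed.

End CountableGeneration.

Lemma fspan_image (R : pzRingType) (V W : lmodType R) (f : {linear V -> W}) e n x :
  fspan e n x -> fspan (fun i => f (e i)) n (f x).
Proof.
move=> [c ->]; exists c; rewrite linear_sum.
by apply: eq_bigr => i _; rewrite linearZ.
Qed.

Lemma countably_generated_isomorphic (R : pzRingType) (V W : lmodType R) :
  isomorphic V W -> countably_generated V -> countably_generated W.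
Proof.
move=> /isomorphic_sections[f [g [fg gf]]] /countably_generated_seq[e he].
apply: (@seq_countably_generated _ _ (fun i => f (e i))) => w.
have [n hn] := he (g w); exists n.
by rewrite -[w]gf; apply: fspan_image.
Qed.

Lemma countably_generated_base_change (R S : comPzRingType)
    (phi : {rmorphism R -> S}) (X : lmodType R) :
  countably_generated X -> countably_generated (base_change phi X).
Proof.
have tS := @tensor_semilinear _ _ phi X.
move=> /countably_generated_seq[e he].
apply: (@seq_countably_generated _ _ (fun i => tensor phi (e i) 1)) => w.
have [n [x [s ->]]] := base_change_sum w.
have [m hm] : exists m, forall i, (i < n)%N -> fspan e m (x i).
  apply: (@common_bound (fun i m => fspan e m (x i))) => [i k l kl|i _].
    exact: fspan_le.
  exact: he.
exists m; apply: (@fspan_sum _ _ _ m n s (fun i => tensor phi (x i) 1)) => i /hm[c ->].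
exists (fun j => phi (c j)); rewrite (semilinear_sum tS).
by apply: eq_bigr => j _; rewrite (semilinearZ tS).
Qed.

Section CountableDescent.
Variables (R : idomainType) (S : comPzRingType) (phi : {rmorphism R -> S}).
Hypothesis dphi : dense_extension phi.

(** The elements of X that occur in generators of S \otimes X generate X, by
    faithful flatness. *)
Lemma countably_generated_descent (X : lmodType R) :
  countably_generated (base_change phi X) -> countably_generated X.
Proof.
move=> /countably_generated_seq[e he].
have /choice[n /choice[x /choice[s hs]]] := fun k => base_change_sum (e k).
pose g k : X := if unpickle k is Some (i, j) then x i j else 0.
have gE i j : g (pickle (i, j)) = x i j by rewrite /g pickleK.
apply: (@seq_countably_generated _ _ g) => v.
have [k hk] := he (tensor phi v 1).
pose E : set (nat -> X) := [set w | exists m, fspan g m (w 0%N)].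
have [||| w [m hm] vw] := @dense_faithful_span _ _ _ dphi X 1 E (fun=> v).
- by exists 0%N; apply: fspan0.
- move=> a y z [my hy] [mz hz]; exists (maxn my mz); apply: fspan_lin.
    by apply: fspan_le hy; apply: leq_maxl.
  by apply: fspan_le hz; apply: leq_maxr.
- have [c hc] := hk.
  apply: (@tensor_span_sum _ _ phi X 1 E k c (fun i _ => e i)) => // i _.
  apply: (@tensor_span_sum _ _ phi X 1 E (n i) (s i) (fun j _ => tensor phi (x i j) 1)) => // j _.
  apply: (@tensor_span_in _ _ phi X 1 E (fun=> x i j)).
  by exists (pickle (i, j)).+1; rewrite -gE; apply: fspan_gen.
- by exists m; rewrite (vw 0%N isT).
Qed.

End CountableDescent.

Section Independence.
Variables (R : idomainType) (X : lmodType R).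

Definition independent (A : set X) : Prop :=
  forall (s : seq X) (c : X -> R), uniq s -> (forall x, x \in s -> A x) ->
    \sum_(x <- s) c x *: x = 0 -> forall x, x \in s -> c x = 0.

Lemma exists_maximal_independent : exists A : set X, independent A /\
  forall x, exists (d : R) (s : seq X) (c : X -> R),
    [/\ d != 0, forall y, y \in s -> A y & d *: x = \sum_(y <- s) c y *: y].
Proof.
have [F Fi Ftot|A [Ai Amax]] := @Zorn_bigcup _ (@independent).
  move=> s c us hs; suff [A FA sA] : exists2 A, independent A & forall x, x \in s -> A x.
    exact: FA.
  have [->|s0] := eqVneq s [::].
    exists set0 => // t d _ ht _ x /ht; by [].
  suff [A FA sA] : exists2 A, F A & forall x, x \in s -> A x by exists A => //; exact: Fi.
  elim: s s0 us hs => // x s IH _ /= /andP[_ us] hs.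
  have [A FA Ax] := hs x (mem_head _ _).
  have [->|s0] := eqVneq s [::].
    by exists A => // y; rewrite inE => /eqP ->.
  have [|B FB sB] := IH s0 us; first by move=> y ys; apply: hs; rewrite inE ys orbT.
  have [AB|BA] := Ftot A B FA FB.
    by exists B => // y; rewrite inE => /orP[/eqP ->|/sB //]; apply: AB.
  by exists A => // y; rewrite inE => /orP[/eqP -> //|/sB]; apply: BA.
exists A; split=> // x.
have [Ax|nAx] := pselect (A x).
  exists 1, [:: x], (fun=> 1); split; first exact: oner_neq0.
    by move=> y; rewrite inE => /eqP ->.
  by rewrite big_seq1.
pose B := [set y | A y \/ y = x].
have : ~ independent B.
  apply: Amax; split; last by move=> BA; apply: nAx; apply: BA; right.
  by move=> y; left.
move=> nB; apply: contrapT => nx; apply: nB => s c us sB s0.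
have [xs|xs] := boolP (x \in s); last first.
  apply: (Ai s c us _ s0) => y ys; case: (sB y ys) => // yx.
  by rewrite -yx ys in xs.
have remA y : y \in rem x s -> A y.
  rewrite mem_rem_uniq // inE => /andP[/eqP yx /sB[]//].
move: s0; rewrite (big_rem x) //= => /eqP; rewrite addr_eq0 => /eqP s0.
have cx : c x = 0.
  apply: contrapT => /eqP cx; apply: nx.
  exists (c x), (rem x s), (fun y => - c y); split=> //.
  by rewrite s0 -sumrN; apply: eq_bigr => y _; rewrite scaleNr.
have s0' : \sum_(y <- rem x s) c y *: y = 0.
  by apply/eqP; rewrite -oppr_eq0 -s0 cx scale0r.
move=> y ys; have [->//|yx] := eqVneq y x.
apply: (Ai _ _ _ remA s0'); first exact: rem_uniq.
by rewrite mem_rem_uniq // inE yx.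
Qed.

End Independence.

(** * Extended modules become free *)

Section ExtendedFree.
Variables (R : idomainType) (S : comPzRingType) (phi : {rmorphism R -> S}).
Hypothesis dphi : dense_extension phi.
Local Notation T := (total_quotient_ring S).
Local Notation psi := (@to_tqr S : {rmorphism S -> T}).

Lemma dense_nontrivial : (1 : S) <> 0.
Proof.
move=> one0; have [|i] := @dense_local _ _ _ dphi 0 (fun=> 0) (fun=> 0); last by [].
by rewrite big_ord0.
Qed.

Lemma tqr_nontrivial : (1 : T) <> 0.
Proof.
by rewrite -(rmorph1 psi) -(rmorph0 psi) => /to_tqr_inj; apply: dense_nontrivial.
Qed.

Variables (N : lmodType S) (X : lmodType R).
Hypothesis extN : extended_from phi N X.

(** A maximal independent family of X is a basis: it generates because nonzero
    elements of R are invertible in T, and it stays independent by flatness of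
    S over R. *)
Lemma extended_free : exists L : Type,
  isomorphic (base_change psi N) (dsum L T^o).
Proof.
have tN := @tensor_semilinear _ _ psi N.
have tX := @tensor_semilinear _ _ phi X.
have [f [g [fg gf]]] := isomorphic_sections extN.
have [A [Ai Agen]] := exists_maximal_independent X.
pose bX (x : X) : base_change psi N := tensor psi (g (tensor phi x 1)) 1.
have bX_lin a x y : bX (a *: x + y) = psi (phi a) *: bX x + bX y.
  by rewrite /bX tX linearP tN.
pose L := {x : X | A x}; exists L.
pose h (l : L) (q : T^o) := (q : T) *: bX (sval l).
have lin_h l : linear (h l).
  by move=> a q q'; rewrite /h scalerDl -scalerA.
have linG := dsum_out_linear lin_h.
apply: (proj2 (isomorphic_bij linG _ _)) => [w|z].
- have [s [us hs]] := dsum_covers w.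
  rewrite (dsum_outE lin_h (conj us hs)) /h.
  have [d [dreg hd]] := tqr_common_denominator [seq (w l : T) | l <- s].
  have /choice[c hc] : forall l : L, exists c, (l : {classic L}) \in s ->
      psi d * (w l : T) = psi c.
    move=> l; have [ls|_] := boolP ((l : {classic L}) \in s); last by exists 0.
    have [|c hc] := hd (w l); last by exists c.
    exact: (map_f (fun l : {classic L} => (w l : T)) ls).
  (* coefficients indexed by X rather than by the subtype of A *)
  have /choice[cX hcX] : forall y : X, exists cy, forall Ay : A y, cy = c (exist _ y Ay).
    move=> y; have [Ay|nAy] := pselect (A y); last by exists 0 => Ay.
    by exists (c (exist _ y Ay)) => Ay'; congr c; apply: eq_exist.
  have cXE l : cX (sval l) = c l by case: l => y Ay; apply: hcX.
  pose t := [seq sval l | l : {classic L} <- s].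
  have ut : uniq t.
    by rewrite map_inj_uniq // => -[x Ax] [y Ay] /= xy; apply: eq_exist.
  have tA y : y \in t -> A y by move=> /mapP[[x Ax] _ ->].
  move=> /(congr1 (fun z => psi d *: z)); rewrite scaler0 scaler_sumr => w0.
  have : tensor psi (\sum_(y <- t) cX y *: g (tensor phi y 1)) 1 = 0.
    rewrite (semilinear_sum tN) big_map -[RHS]w0 big_seq [RHS]big_seq.
    apply: eq_bigr => l ls.
    by rewrite (semilinearZ tN) scalerA hc // cXE.
  move=> /tqr_tensor_eq0[d' [d'reg]] /(congr1 f).
  rewrite linear0 linearZ /= linear_sum scaler_sumr (big_nth 0) big_mkord => c0.
  have [|p [B [u [Bt cu]]]] := @dense_flat_tensor _ _ _ dphi X (size t) (nth 0 t)
      (fun i => d' * cX (nth 0 t i)).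
    rewrite -[RHS]c0; apply: eq_bigr => i _.
    by rewrite linearZ /= gf scalerA.
  have B0 q i : (q < p)%N -> (i < size t)%N -> B q i = 0.
    move=> qp it.
    have := Ai t (fun y => B q (index y t)) ut tA _ _ (mem_nth 0 it).
    rewrite index_uniq // => -> //.
    rewrite (big_nth 0) big_mkord -[RHS](Bt q qp); apply: eq_bigr => j _.
    by rewrite index_uniq.
  have c0' l : (l : {classic L}) \in s -> c l = 0.
    move=> ls; have lt : sval l \in t by apply: map_f.
    apply: d'reg; rewrite mulr0 -cXE -(nth_index 0 lt) cu ?index_mem //.
    by rewrite big1 // => q _; rewrite B0 ?rmorph0 ?mulr0 ?index_mem.
  apply: dsum_ext => l; rewrite dsum_val0.
  apply: contrapT => wl; have ls := hs _ wl; apply: wl.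
  by apply: (tqr_lreg dreg); rewrite hc // c0' // rmorph0 mulr0.
- pose Im v := exists w, dsum_out h w = v.
  have ImD a v v' : Im v -> Im v' -> Im (a *: v + v').
    by move=> [w <-] [w' <-]; exists (a *: w + w'); rewrite linG.
  have Im0 : Im 0 by exists 0; exact: linear0P.
  have Im_sum k (a : nat -> T) (F : nat -> base_change psi N) :
      (forall i, (i < k)%N -> Im (F i)) -> Im (\sum_(i < k) a i *: F i).
    elim: k => [|k IH] hF; first by rewrite big_ord0.
    rewrite big_ord_recr /= addrC; apply: ImD; first exact: hF.
    by apply: IH => i ik; apply: hF; rewrite ltnS ltnW.
  have Imb (l : L) : Im (bX (sval l)).
    exists (dsum_in l (1 : T^o)); rewrite (dsum_outE lin_h (s := [:: l : {classic L}])).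
      by rewrite big_seq1 dsum_inE eqxx /h scale1r.
    split=> // i; rewrite dsum_inE inE; by case: eqP.
  have ImX x : Im (bX x).
    have [d [s [c [d0 sA dx]]]] := Agen x.
    have [q qd] := tqr_unit (dense_reg dphi d0).
    rewrite -[bX x]scale1r -qd -scalerA.
    have -> : psi (phi d) *: bX x = \sum_(i < size s) psi (phi (c s`_i)) *: bX s`_i.
      have bS : semilinear_map (psi \o phi) bX by exact: bX_lin.
      rewrite -(semilinearZ bS d) dx (big_nth 0) big_mkord (semilinear_sum bS).
      by apply: eq_bigr => i _; rewrite (semilinearZ bS).
    rewrite -[_ *: _]addr0; apply: (ImD) => //.
    apply: Im_sum (fun i => psi (phi (c s`_i))) (fun i => bX s`_i) _ => i iS.
    exact: (Imb (exist _ _ (sA _ (mem_nth 0 iS)))).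
  have [k [n [q ->]]] := base_change_sum z.
  apply: (Im_sum _ q (fun i => tensor psi (n i) 1)) => i _.
  have [k' [x [s fn]]] := base_change_sum (f (n i)).
  rewrite -[n i]fg fn linear_sum (semilinear_sum tN).
  under eq_bigr do rewrite linearZ /= (semilinearZ tN).
  apply: (Im_sum _ (fun i => psi (s i)) (fun i => bX (x i))) => j _; exact: ImX.
Qed.

(** The supports of countably many generators cover the index set. *)
Lemma free_countable (L : Type) : countably_generated N ->
  isomorphic (base_change psi N) (dsum L T^o) -> countable [set: L].
Proof.
move=> cgN iso.
have /countably_generated_seq[e he] :=
  countably_generated_isomorphic iso (countably_generated_base_change psi cgN).
have /choice[s hs] := fun k => dsum_covers (e k).
have -> : [set: L] = \bigcup_k [set` s k].
  apply/seteqP; split=> // l _.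
  have [n [c hc]] := he (dsum_in l (1 : T^o)).
  apply: contrapT => nl; apply: tqr_nontrivial.
  have := congr1 (fun w : dsum L T^o => w l) hc.
  rewrite dsum_inE eqxx => ->; rewrite dsum_val_sum big1 // => i _.
  rewrite dsum_valZ (_ : e i l = 0) ?scaler0 //.
  apply: contrapT => eil; apply: nl; exists (val i) => //=.
  by have [_ h] := hs (val i); apply: h.
apply: bigcup_countable => // k _; apply: finite_set_countable.
exact: (@finite_seq {classic L}).
Qed.

End ExtendedFree.

(** * Modules that become free are extended *)

Section RestrictScalars.
Variables (R S : comPzRingType) (phi : {rmorphism R -> S}) (N : lmodType S).

Definition restrict_scalars of GRing.RMorphism.type R S : Type := N.
Local Notation resN := (restrict_scalars phi).

HB.instance Definition _ := GRing.Zmodule.copy resN N.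

Definition res_scale (a : R) (x : resN) : resN := phi a *: (x : N).

Fact res_scaleA a b x : res_scale a (res_scale b x) = res_scale (a * b) x.
Proof. by rewrite /res_scale scalerA rmorphM. Qed.

Fact res_scale1 : left_id 1 res_scale.
Proof. by move=> x; rewrite /res_scale rmorph1 scale1r. Qed.

Fact res_scaleDr : right_distributive res_scale +%R.
Proof. by move=> a x y; rewrite /res_scale -scalerDr. Qed.

Fact res_scaleDl x : {morph res_scale^~ x : a b / a + b}.
Proof. by move=> a b; rewrite /res_scale rmorphD scalerDl. Qed.

HB.instance Definition _ := GRing.Zmodule_isLmodule.Build R resN
  res_scaleA res_scale1 res_scaleDr res_scaleDl.

End RestrictScalars.

Section FreeExtended.
Variables (R : idomainType) (S : comPzRingType) (phi : {rmorphism R -> S}).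
Hypothesis dphi : dense_extension phi.
Variable r : R.
Hypotheses (r0 : r != 0)
  (reg_divides : forall s : S, GRing.lreg s -> exists k, divides s (phi r ^+ k)).
Local Notation T := (total_quotient_ring S).
Local Notation psi := (@to_tqr S : {rmorphism S -> T}).
Variables (N : lmodType S) (L : Type).
Hypothesis tfN : forall (d : R) (n : N), d != 0 -> phi d *: n = 0 -> n = 0.
Hypothesis isoN : isomorphic (base_change psi N) (dsum L T^o).

Let rX0 k : r ^+ k != 0. Proof. exact: expf_neq0. Qed.

(** N is a lattice in the free module: it embeds by torsion-freeness, and
    generates it up to powers of r because a regular element divides one. *)
Lemma free_lattice : exists j : N -> dsum L T^o,
  [/\ semilinear_map psi j, (forall n, j n = 0 -> n = 0) &
      forall w, exists k n, psi (phi (r ^+ k)) *: w = j n].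
Proof.
have [F [G [FG GF]]] := isomorphic_sections isoN.
have tN := @tensor_semilinear _ _ psi N.
have jS : semilinear_map psi (fun n => F (tensor psi n 1)).
  by move=> a x y; rewrite tN linearP.
exists (fun n => F (tensor psi n 1)); split=> // [n jn|w].
  have /tqr_tensor_eq0[s [sreg sn]] : tensor psi n 1 = 0.
    by apply: (can_inj FG); rewrite jn linear0.
  have [k [t kt]] := reg_divides sreg.
  by apply: (tfN (rX0 k)); rewrite rmorphXn kt mulrC -scalerA sn scaler0.
have [s [n [sreg sw]]] := tqr_tensor_fraction (G w).
have [k [t kt]] := reg_divides sreg.
exists k, (t *: n); rewrite (semilinearZ jS) -sw linearZ /= GF scalerA.
by rewrite rmorphXn kt -rmorphM mulrC.
Qed.

(** X consists of the elements of N all of whose coordinates are fractions a/r^k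
    with a in R. *)
Lemma free_extended : exists X : lmodType R,
  torsion_free X /\ isomorphic N (base_change phi X).
Proof.
have [j [jS j_inj j_frac]] := free_lattice.
pose integral k (n : N) := forall l, exists a : R,
  psi (phi (r ^+ k)) * (j n l : T) = psi (phi a).
have integral_le k k' n : (k <= k')%N -> integral k n -> integral k' n.
  move=> kk h l; have [a ha] := h l; exists (r ^+ (k' - k) * a).
  by rewrite -{1}(subnK kk) exprD !rmorphM -mulrA ha.
pose A : set (restrict_scalars N phi) := [set n | exists k, integral k n].
have subA : is_submodule A.
  split=> [|a x y [k hx] [k' hy]].
    exists 0%N => l; exists 0.
    by rewrite (semilinear0 jS) dsum_val0 mulr0 !rmorph0.
  exists (maxn k k') => l.
  have [b hb] := integral_le _ _ _ (leq_maxl k k') hx l.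
  have [c hc] := integral_le _ _ _ (leq_maxr k k') hy l.
  exists (a * b + c); rewrite !rmorphD !rmorphM -hb -hc.
  have -> : j (a *: x + y) = psi (phi a) *: j x + j y by exact: jS.
  by rewrite dsum_valP mulrDr [X in X + _]mulrCA.
pose X : lmodType R := submodule subA.
pose i (x : X) : N := submod_val x.
have iS : semilinear_map phi i.
  by move=> a x y; rewrite /i submod_val_linear.
have i_inj x : i x = 0 -> x = 0 by move=> x0; apply: val_inj.
have tX := @tensor_semilinear _ _ phi X.
exists X; split.
  move=> d x; have [->|d0] := eqVneq d 0; first by left.
  move=> /(congr1 i); rewrite (semilinearZ iS) (semilinear0 iS) => /(tfN d0)/i_inj.
  by right.
have [F FE] := base_change_lift iS.
apply: (proj2 (@isomorphic_bij _ _ _ F _ _ _)) => [a x y|t|n].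
- exact: linearP.
- have [p [x [s ->]]] := base_change_sum t.
  rewrite linear_sum; under eq_bigr do rewrite FE.
  move=> sx0.
  have [k hk] : exists k, forall q, (q < p)%N -> integral k (i (x q)).
    apply: (@common_bound (fun q k => integral k (i (x q)))) => [q k k'|q _].
      exact: integral_le.
    exact: (submod_valP (x q)).
  have /choice[a ha] : forall q, exists a : L -> R, (q < p)%N -> forall l,
      psi (phi (r ^+ k)) * (j (i (x q)) l : T) = psi (phi (a l)).
    move=> q; have [/hk/choice[a ha]|_] := boolP (q < p)%N; first by exists a.
    by exists (fun=> 0).
  have sa l : \sum_(q < p) s q * phi (a q l) = 0.
    apply: to_tqr_inj; rewrite rmorph0 rmorph_sum.
    transitivity (psi (phi (r ^+ k)) * (j (\sum_(q < p) s q *: i (x q)) l : T)).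
      rewrite (semilinear_sum jS) dsum_val_sum mulr_sumr; apply: eq_bigr => q _.
      by rewrite (semilinearZ jS) dsum_valZ rmorphM -ha // mulrCA.
    by rewrite sx0 (semilinear0 jS) dsum_val0 mulr0.
  have [p' [B [u [Ba su]]]] := dense_flat dphi sa.
  have Bx q : (q < p')%N -> \sum_(q' < p) B q q' *: x q' = 0.
    move=> qp; apply/i_inj/j_inj/dsum_ext => l; rewrite dsum_val0.
    apply: (tqr_lreg (dense_reg dphi (rX0 k))); rewrite mulr0.
    rewrite (semilinear_sum iS) (semilinear_sum jS) dsum_val_sum mulr_sumr.
    transitivity (psi (phi (\sum_(q' < p) B q q' * a q' l))); last first.
      by rewrite Ba // !rmorph0.
    rewrite !rmorph_sum; apply: eq_bigr => q' _.
    by rewrite (semilinearZ iS) (semilinearZ jS) dsum_valZ !rmorphM -ha // mulrCA.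
  transitivity (\sum_(q < p') u q *: tensor phi (\sum_(q' < p) B q q' *: x q') 1).
    under [RHS]eq_bigr do rewrite (semilinear_sum tX) scaler_sumr.
    rewrite exchange_big; apply: eq_bigr => q' _ /=; rewrite su // scaler_suml.
    by apply: eq_bigr => q _; rewrite (semilinearZ tX) scalerA.
  by rewrite big1 // => q _; rewrite Bx // (semilinear0 tX) scaler0.
pose Im n := exists t, F t = n.
have ImD a x y : Im x -> Im y -> Im (a *: x + y).
  by move=> [t <-] [t' <-]; exists (a *: t + t'); rewrite linearP.
have Imi x : Im (i x) by exists (1 *: tensor phi x 1); rewrite FE scale1r.
have Im0 : Im 0 by exists 0; rewrite linear0.
(* The S-span of X is saturated: if r n' is the sum of the s q x q, write
   s q = c q + r t q; then n' minus the sum of the t q x q is in X. *)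
have Imr n' : Im (phi r *: n') -> Im n'.
  move=> [t]; have [p [x [s ->]]] := base_change_sum t.
  rewrite linear_sum; under eq_bigr do rewrite FE.
  have /choice[ct hct] : forall q, exists ct : R * S, s q = phi ct.1 + phi r * ct.2.
    by move=> q; have [c [t' ->]] := dense_split dphi (s q) r0; exists (c, t').
  move=> sxE; pose z := \sum_(q < p) (ct q).2 *: i (x q).
  have Ay : A (n' - z : N).
    have [k hk] := submod_valP (\sum_(q < p) (ct q).1 *: x q).
    exists k.+1 => l; have [a ha] := hk l; exists a; rewrite -ha.
    rewrite exprSr rmorphM [psi _]rmorphM -mulrA; congr (_ * _).
    have -> : psi (phi r) * (j (n' - z) l : T) = (j (phi r *: (n' - z)) l : T).
      by rewrite (semilinearZ jS) dsum_valZ.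
    congr (j _ l : T).
    rewrite scalerBr -sxE -[RHS]/(i _) (semilinear_sum iS) scaler_sumr -sumrB.
    apply: eq_bigr => q _; rewrite (semilinearZ iS) hct scalerDl scalerA.
    by rewrite addrK.
  rewrite -[n'](subrK z) -[n' - z]scale1r; apply: (ImD).
    exact: (Imi (submod_in subA Ay)).
  rewrite /z; elim/big_rec: _ => // q y _; exact: ImD.
have ImrX k n' : Im (phi (r ^+ k) *: n') -> Im n'.
  elim: k n' => [|k IH] n'; first by rewrite expr0 rmorph1 scale1r.
  by rewrite exprSr rmorphM -scalerA => /IH/Imr.
(* D w: up to a power of r, the vector w is in the S-span of X *)
pose D (w : dsum L T^o) := exists k n', Im n' /\ psi (phi (r ^+ k)) *: w = j n'.
have DD w w' : D w -> D w' -> D (w + w').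
  move=> [k [m1 [Im1 h1]]] [k' [m2 [Im2 h2]]]; exists (k + k')%N.
  exists (phi (r ^+ k') *: m1 + (phi (r ^+ k) *: m2 + 0)); split.
    by apply: (ImD) => //; apply: ImD.
  rewrite addr0 jS (semilinearZ jS) -h1 -h2 !scalerA -!rmorphM -!exprD.
  by rewrite addnC scalerDr.
have Din l (q : T^o) : D (dsum_in l q).
  have [a [s [sreg sq]]] := tqr_fraction q.
  have [k [t kt]] := reg_divides sreg.
  have [k' [e he]] := j_frac (dsum_in l (1 : T^o)).
  have Ae : A e.
    exists 0%N => l'; rewrite -he dsum_valZ dsum_inE expr0 !rmorph1 mul1r.
    case: eqP => _; last by exists 0; rewrite scaler0 !rmorph0.
    by exists (r ^+ k'); rewrite -[LHS]/(_ * _) mulr1.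
  exists (k + k')%N, ((t * a) *: e); split.
    rewrite -[_ *: e]addr0; apply: ImD => //; exact: (Imi (submod_in subA Ae)).
  rewrite (semilinearZ jS) -he exprD !rmorphM -!scalerA [RHS]scalerA [RHS]scalerA.
  apply: dsum_ext => l'; rewrite !dsum_valZ !dsum_inE.
  case: eqP => _; last by rewrite !scaler0.
  rewrite -[LHS]/(psi (phi (r ^+ k)) * (psi (phi (r ^+ k')) * q)).
  rewrite -[RHS]/(psi t * psi a * psi (phi (r ^+ k')) * 1) mulr1.
  rewrite -sq rmorphXn kt rmorphM mulrCA [RHS]mulrC; congr (_ * _).
  by rewrite [RHS]mulrA [psi t * _]mulrC.
have [s hs] := dsum_covers (j n).
have [k [n' [Imn' hn']]] : D (j n).
  rewrite (dsum_sum_in hs); elim/big_rec: _ => [|l w _]; last exact: DD.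
  by exists 0%N, 0; rewrite scaler0 (semilinear0 jS).
apply: (ImrX k).
have -> // : phi (r ^+ k) *: n = n'.
apply/eqP; rewrite -subr_eq0; apply/eqP/j_inj.
by rewrite (semilinearD jS) (semilinearN jS) (semilinearZ jS) hn' subrr.
Qed.

End FreeExtended.

Lemma base_change_Add_torsion_free (R : idomainType) (S : comPzRingType)
    (phi : {rmorphism R -> S}) (M : lmodType R) (N : lmodType S) :
  dense_extension phi -> torsion_free M -> in_Add (base_change phi M) N ->
  forall (d : R) (n : N), d != 0 -> phi d *: n = 0 -> n = 0.
Proof.
move=> dphi tfM /in_Add_section[L [sigma [rho rs]]] d n d0 dn.
rewrite -[n]rs (_ : sigma n = 0) ?linear0 //; apply: dsum_ext => l.
rewrite dsum_val0; apply: (base_change_torsion_free dphi tfM d0).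
by rewrite -dsum_valZ -linearZ dn linear0 dsum_val0.
Qed.

(** * The theorem *)

Unset Implicit Arguments.

Theorem theorem11p8 (R : idomainType) (m : set R)
    (R_local : local_ring_with m) (R_noetherian : noetherian R)
    (R_dim1 : krull_dim R 1)
    (Rhat_reduced : reduced (completion m))
    (M : lmodType R) (M_fg : finitely_generated M) (M_tf : torsion_free M)
    (N : lmodType (completion m)) (N_cg : countably_generated N)
    (N_Add : in_Add (base_change (to_completion m) M) N) :
  let extended := exists X : lmodType R, extended_from (to_completion m) N X in
  let free_over_total_quotient := exists L : Type, countable [set: L] /\
    isomorphic (base_change (@to_tqr (completion m)) N)
               (dsum L (total_quotient_ring (completion m))^o) in
  let extended_from_Add := exists X : lmodType R,
    [/\ countably_generated X, in_Add M X
      & extended_from (to_completion m) N X] in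
  (extended <-> free_over_total_quotient) /\ (free_over_total_quotient <-> extended_from_Add).
Proof.
have dphi := completion_dense R_local R_noetherian R_dim1.
move=> extended free extAdd.
have ext_free : extended -> free.
  move=> [X extX]; have [L isoL] := extended_free dphi extX.
  by exists L; split=> //; exact: (free_countable dphi N_cg isoL).
have free_Add : free -> extAdd.
  move=> [L [_ isoL]].
  have [r mr r0] := dim1_nonzero_nonunit R_local R_noetherian R_dim1.
  have reg s := completion_reg_divides R_local R_noetherian R_dim1 mr r0 (s := s).
  have tfN := base_change_Add_torsion_free dphi M_tf N_Add.
  have [X [tfX isoX]] := free_extended dphi r0 reg tfN isoL.
  have cgX : countably_generated X.
    apply: (countably_generated_descent dphi).
    exact: countably_generated_isomorphic isoX N_cg.
  exists X; split=> //.
  have [gM [nM gen_M]] := finitely_generated_seq M_fg.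
  have [e gen_e] := countably_generated_seq cgX.
  apply: (Add_descent dphi gen_M M_tf gen_e tfX).
  exact: in_Add_isomorphic isoX N_Add.
have Add_ext : extAdd -> extended by move=> [X [_ _ extX]]; exists X.
by split; split=> // h; [apply/Add_ext/free_Add | apply/ext_free/Add_ext].
Qed.
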